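(* Let $\alpha(t)=\sum_{n\ge 0}\alpha_n t^n$ be a function with real Taylor coefficients belonging to the Wiener algebra $A_W$, which does not vanish on $\mathbb{D}$, with $\alpha_0=1$. Put $k(t)=1/\alpha(t)=\sum_{n\ge0}k_nt^n$ ($t\in\mathbb{D}$), so that $k_0=1$, and assume $k_n>0$ for every $n\ge 1$. Suppose that $k\in A_W$, $k_n^{1/n}\to 1$, $\sup_n k_n/k_{n+1}<\infty$ and $$\lim_{m\to\infty}\ \sup_{n\ge 2m}\ \sum_{m\le j\le n/2}\frac{k_jk_{n-j}}{k_n}=0 .$$ Then $B_k$ is bounded on $\mathcal{H}_k$, and an operator $T\in L(H)$ on a Hilbert space $H$ is unitarily equivalent to a part of $B_k\otimes I_{\mathcal{E}}$ for some Hilbert space $\mathcal{E}$ if and only if both series $\sum_{n}|\alpha_n|T^{*n}T^n$ and $\sum_n k_nT^{*n}T^n$ converge in the strong operator topology in $L(H)$ and $\alpha(T^*,T)\ge 0$. Moreover, in this case one can take $\mathcal{E}=\mathfrak{D}$.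
   Context: All Hilbert spaces are separable and complex; $L(H)$ is the algebra of bounded linear operators on $H$. $\mathbb{D}$ is the open unit disc. $A_W$ is the Wiener algebra of analytic functions on $\mathbb{D}$ with absolutely summable Taylor coefficients. A part of an operator is its restriction to a closed invariant subspace. $\mathcal{H}_k$ is the Hilbert space of power series $f(t)=\sum_{n\ge0}f_nt^n$ with finite norm $\|f\|_{\mathcal{H}_k}=\big(\sum_{n\ge0}|f_n|^2k_n\big)^{1/2}$, and $B_k$ is the backward shift $B_kf(t)=(f(t)-f(0))/t$ on $\mathcal{H}_k$. The space $\mathcal{H}_k\otimes\mathcal{E}$ is identified with the space of $\mathcal{E}$-valued power series with norm $\big(\sum_n\|f_n\|_{\mathcal{E}}^2k_n\big)^{1/2}$, and $B_k\otimes I_{\mathcal{E}}$ acts by the same formula. $\alpha(T^*,T)=\sum_{n\ge0}\alpha_nT^{*n}T^n$, with convergence in the strong operator topology (SOT); the SOT convergence of $\sum|\alpha_n|T^{*n}T^n$ implies that of $\sum\alpha_nT^{*n}T^n$. When $\alpha(T^*,T)\ge0$, put $D=(\alpha(T^*,T))^{1/2}$ (non-negative square root) and $\mathfrak{D}=\overline{DH}$. *)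

(* Defs.v *)
From HB Require Import structures.
From mathcomp Require Import all_boot all_order all_algebra.
From mathcomp Require Import complex.
From mathcomp Require Import all_classical all_reals all_analysis.
From mathcomp Require Import ring lra.
Set Implicit Arguments.
Unset Strict Implicit.
Unset Printing Implicit Defensive.
Import Order.TTheory GRing.Theory Num.Theory numFieldNormedType.Exports.
Local Open Scope classical_set_scope.
Local Open Scope ring_scope.
Local Open Scope complex_scope.

(* Separable complex Hilbert spaces. As in sesquilinear.v, the inner product
   is linear in its first argument and conjugate-linear in the second one. *)
HB.mixin Record isHilbert (R : realType) H & CompleteNormedModule R[i] H := {
  hdot : {dot H for Num.conj};
  sqr_hnorm : forall x : H, `|x| ^+ 2 = hdot x x;
  hseparable : exists2 A : set H, countable A & dense A
}.

#[short(type="hilbertType")]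
HB.structure Definition Hilbert (R : realType) :=
  {H of CompleteNormedModule R[i] H & isHilbert R H}.

Notation "''[' x , y ]" := (hdot x y)
  (format "''[' x ,  y ]") : ring_scope.

Section BoundedOperators.
Variables (R : realType) (V W : normedModType R[i]).

Record bounded_operator := BoundedOperator {
  bop_fun :> {linear V -> W};
  bop_continuous : continuous bop_fun
}.

HB.instance Definition _ := gen_eqMixin bounded_operator.
HB.instance Definition _ := gen_choiceMixin bounded_operator.

Lemma null_continuous : continuous (\0 : {linear V -> W}).
Proof. by move=> x; exact: cvg_cst. Qed.

Definition bop0 := BoundedOperator null_continuous.

End BoundedOperators.

Notation "''L' ( V , W )" := (bounded_operator V W) (format "''L' ( V ,  W )")
  : type_scope.
Notation "''L' ( V )" := 'L(V, V) (format "''L' ( V )") : type_scope.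

Section ClosedSubspaces.
Variables (R : realType) (V : normedModType R[i]).

Record closed_subspace := ClosedSubspace {
  csub_set :> set V;
  csub_closed : closed csub_set;
  csub_submod : submod_closed (mem csub_set)
}.

Lemma closure_submod (A : set V) :
  submod_closed (mem A) -> submod_closed (mem (closure A)).
Proof.
move=> [A0 AZD]; split=> [|a x y]; rewrite !inE.
  by apply: subset_closure; rewrite -inE.
move=> clx cly B /nbhs_ballP[e e0 Be].
have ea : 0 < e / (2 * (`|a| + 1)).
  by rewrite divr_gt0// mulr_gt0// ltr_wpDl.
have [x' [Ax' xx']] := clx _ (nbhsx_ballx x _ ea).
have [y' [Ay' yy']] := cly _ (nbhsx_ballx y _ (divr_gt0 e0 (ltr0Sn _ 1))).
exists (a *: x' + y'); split.
  by rewrite -inE; apply: AZD; rewrite inE.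
apply: Be; move: xx' yy'; rewrite -!ball_normE/= => xx' yy'.
rewrite opprD addrACA -scalerBr (le_lt_trans (ler_normD _ _))//.
rewrite (splitr e) ler_ltD// normrZ.
rewrite (@le_trans _ _ (`|a| * (e / (2 * (`|a| + 1)))))//.
  by rewrite ler_wpM2l// ltW.
rewrite (_ : `|a| * _ = e / 2 * (`|a| / (`|a| + 1))); last first.
  by rewrite invfM; ring.
rewrite ger_pMr ?divr_gt0//.
by rewrite ler_pdivrMr ?mul1r ?lerDl ?ler01// ltr_wpDl.
Qed.

End ClosedSubspaces.

Section RangeClosure.
Variables (R : realType) (V W : normedModType R[i]) (A : 'L(V, W)).

Lemma range_submod : submod_closed (mem (range A)).
Proof.
split=> [|a x y]; rewrite !inE.
  by exists 0; rewrite ?linear0.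
by move=> -[u _ <-] [v _ <-]; exists (a *: u + v); rewrite ?linearP.
Qed.

Definition range_closure : closed_subspace W :=
  ClosedSubspace (@closed_closure _ (range A)) (closure_submod range_submod).

End RangeClosure.

Section SubspaceType.
Variables (R : realType) (V : normedModType R[i]) (M : closed_subspace V).

Definition subspace_pred : {pred V} := mem (M : set V).

Record subspace_type := SubspaceElt {
  subspace_val :> V;
  subspace_valP : subspace_pred subspace_val
}.

HB.instance Definition _ := [isSub for subspace_val].
HB.instance Definition _ := [Choice of subspace_type by <:].

HB.instance Definition _ := GRing.isSubmodClosed.Build _ _
  subspace_pred (csub_submod M).
HB.instance Definition _ := [SubChoice_isSubLmodule of subspace_type by <:].

Let norm (x : subspace_type) : R[i] := `|val x|.
Let normD x y : norm (x + y) <= norm x + norm y.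
Proof. by rewrite /norm raddfD ler_normD. Qed.
Let normZ a x : norm (a *: x) = `|a| * norm x.
Proof. by rewrite /norm linearZ normrZ. Qed.
Let norm0_eq0 x : norm x = 0 -> x = 0.
Proof. by move=> /normr0_eq0 x0; apply: val_inj; rewrite x0 raddf0. Qed.

HB.instance Definition _ :=
  Lmodule_isNormed.Build R[i] subspace_type normD normZ norm0_eq0.

Lemma subspace_normE (x : subspace_type) : `|x| = `|val x|.
Proof. by []. Qed.

End SubspaceType.

Section CompleteSubspace.
Variables (R : realType) (V : completeNormedModType R[i]).
Variable M : closed_subspace V.

Let complete (F : set_system (subspace_type M)) :
  ProperFilter F -> cauchy F -> cvg F.
Proof.
move=> FF Fc.
have /cauchy_cvg/cvg_ex[/= l Fl] : cauchy (val @ F).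
  apply/cauchy_ballP => e e0; move/cauchy_ballP : Fc => /(_ _ e0).
  move=> [[A B] /= [FA FB] AB].
  exists (val @` A, val @` B) => /=.
    by split; [apply: filterS FA|apply: filterS FB] => x Ax; exists x.
  move=> -[_ _] /= [[x Ax <-] [y By <-]].
  by have := AB (x, y) (conj Ax By); rewrite /= -!ball_normE.
have Ml : (M : set V) l.
  apply: (@closed_cvg _ _ F _ val (csub_set M) (@csub_closed _ _ M) _ l Fl).
  by apply: nearW => x; exact: set_mem (subspace_valP x).
apply/cvg_ex; exists (SubspaceElt (mem_set Ml)).
by apply/cvgrPdist_lt => e e0; move/cvgrPdist_lt : Fl => /(_ _ e0).
Qed.

HB.instance Definition _ :=
  Uniform_isComplete.Build (subspace_type M) complete.

End CompleteSubspace.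

Section HilbertSubspace.
Variables (R : realType) (H : hilbertType R) (M : closed_subspace H).

Definition subspace_hdot (x y : subspace_type M) : R[i] := '[val x, val y].

Let dotB : bilinear_for
  (GRing.Scale.Law.clone _ _ ( *%R) _)
  (GRing.Scale.Law.clone _ _ (Num.conj \; *%R) _)
  subspace_hdot.
Proof.
split=> [y a u v|x a u v]; rewrite /subspace_hdot.
  have -> : val (a *: u + v) = a *: val u + val v by rewrite linearP.
  by rewrite linearDl linearZl_LR.
have -> : val (a *: u + v) = a *: val u + val v by rewrite linearP.
by rewrite linearDr linearZr_LR.
Qed.
HB.instance Definition _ := bilinear_isBilinear.Build R[i] _ _ _ _ _ _ dotB.

Let dot_sym x y :
  subspace_hdot x y = (-1) ^+ false * (subspace_hdot y x)^*%R.
Proof. by rewrite /subspace_hdot hermC. Qed.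
HB.instance Definition _ :=
  isHermitianSesquilinear.Build R[i] _ false Num.conj _ dot_sym.

Let dot_gt0 x : x != 0 -> 0 < subspace_hdot x x.
Proof. by move=> x0; rewrite /subspace_hdot dnorm_gt0 raddf_eq0//; exact: val_inj. Qed.
HB.instance Definition _ := isDotProduct.Build _ _ _ dot_gt0.

Let sqr_norm (x : subspace_type M) : `|x| ^+ 2 = subspace_hdot x x.
Proof. exact: sqr_hnorm. Qed.

Let separable : exists2 A : set (subspace_type M), countable A & dense A.
Proof.
have [A cA dA] := @hseparable R H.
pose g (an : H * nat) : subspace_type M :=
  xget 0 [set m | `|val m - an.1| < (an.2.+1%:R : R[i])^-1].
exists (g @` (A `*` setT)).
  by apply: (sub_countable (card_image_le _ _)); exact: countableX.
move=> U [m Um] oU.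
have /nbhs_ballP[e e0 eU] : nbhs m U by exact: open_nbhs_nbhs.
have [n ne] : exists n, (n.+1%:R : R[i])^-1 < e / 2.
  have e2 : 0 < e / 2 by rewrite divr_gt0.
  have re : e / 2 = (complex.Re (e / 2))%:C by rewrite RRe_real// gtr0_real.
  have r0 : 0 < complex.Re (e / 2) by rewrite -ltcR -re.
  exists (Num.truncn (complex.Re (e / 2))^-1).
  rewrite re -(rmorph_nat (real_complex R)) -(fmorphV (real_complex R)) ltcR.
  by rewrite invf_plt ?posrE// truncnS_gt.
have n0 : 0 < (n.+1%:R : R[i])^-1 by rewrite invr_gt0.
have [a [ma Aa]] := dA (ball (val m) (n.+1%:R)^-1)
  (ex_intro _ (val m) (ballxx _ n0)) (ball_open _ _).
have ga : `|val (g (a, n)) - a| < (n.+1%:R : R[i])^-1.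
  apply: (@xgetPex _ 0 [set m | `|val m - a| < (n.+1%:R : R[i])^-1]).
  by exists m; move: ma; rewrite -ball_normE.
exists (g (a, n)); split; last by exists (a, n).
apply: eU; rewrite -ball_normE /= subspace_normE raddfB/=.
rewrite (le_lt_trans (ler_distD a _ _))// (splitr e) ltrD//.
  by move: ma; rewrite -ball_normE/= => /lt_trans; apply.
by rewrite distrC (lt_trans ga).
Qed.

HB.instance Definition _ :=
  isHilbert.Build R (subspace_type M) sqr_norm separable.

End HilbertSubspace.

Section WeightedSpace.
Variables (R : realType) (k : nat -> {posnum R}) (E : normedModType R[i]).
Implicit Types f g : nat -> E.

(* Norms of a normedModType over R[i] take values in R[i]; rnorm is the same
   number, in R. *)
Definition rnorm (x : E) : R := complex.Re `|x|.

Definition weighted_terms f : R^nat := fun n => rnorm (f n) ^+ 2 * (k n)%:num.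

Definition weighted_pred : {pred nat -> E} :=
  fun f => `[< cvgn (series (weighted_terms f)) >].

(* The power series sum_n f_n t^n with f_n in E and finite H_k (x) E norm, given
   by their coefficients; H_k itself is the case E = C. *)
Record weighted_space := WeightedSpace {
  coefs :> nat -> E;
  coefsP : weighted_pred coefs
}.

HB.instance Definition _ := [isSub for coefs].
HB.instance Definition _ := [Choice of weighted_space by <:].

Lemma rnormE x : (rnorm x)%:C = `|x|.
Proof. by rewrite RRe_real ?ger0_real. Qed.

Lemma rnorm_ge0 x : 0 <= rnorm x.
Proof. by rewrite -lecR rnormE; exact: normr_ge0. Qed.

Lemma rnormD x y : rnorm (x + y) <= rnorm x + rnorm y.
Proof. by rewrite -lecR rmorphD/= !rnormE ler_normD. Qed.

Lemma rnormZ a x : rnorm (a *: x) = complex.Re `|a| * rnorm x.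
Proof.
apply: (@complexI R); rewrite rmorphM/= !rnormE normrZ; congr (_ * _).
Qed.

Lemma weighted_terms_ge0 f n : 0 <= weighted_terms f n.
Proof. by rewrite mulr_ge0// sqr_ge0. Qed.

Lemma weighted_series_ge0 f n : 0 <= series (weighted_terms f) n.
Proof. by apply: sumr_ge0 => i _; exact: weighted_terms_ge0. Qed.

Lemma weighted_series_nd f : nondecreasing_seq (series (weighted_terms f)).
Proof. by apply: nondecreasing_series => n _ _; exact: weighted_terms_ge0. Qed.

Lemma weighted_seriesD f g n :
  series (weighted_terms (f + g)) n <=
  (Num.sqrt (series (weighted_terms f) n) +
   Num.sqrt (series (weighted_terms g) n)) ^+ 2.
Proof.
elim: n => [|n ih].
  by rewrite /series/= !big_geq// sqrr_ge0.
have SS (u : R^nat) : series u n.+1 = series u n + u n.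
  by rewrite /series/= big_nat_recr.
rewrite !SS.
set F := series (weighted_terms f) n in ih *.
set G := series (weighted_terms g) n in ih *.
have F0 : 0 <= F := weighted_series_ge0 f n.
have G0 : 0 <= G := weighted_series_ge0 g n.
rewrite (le_trans (lerD ih (lexx _)))// /weighted_terms.
have : rnorm ((f + g) n) ^+ 2 <= (rnorm (f n) + rnorm (g n)) ^+ 2.
  by rewrite ler_sqr ?nnegrE ?rnorm_ge0 ?addr_ge0 ?rnorm_ge0// rnormD.
move: (rnorm _) => c.
have := rnorm_ge0 (f n); have := rnorm_ge0 (g n).
move: (rnorm (f n)) (rnorm (g n)) => a b b0 a0 cab.
have : 0 < (k n)%:num by [].
move: ((k n)%:num) => w w0.
have cw : c ^+ 2 * w <= (a + b) ^+ 2 * w by rewrite ler_wpM2r// ltW.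
rewrite (le_trans (lerD (lexx _) cw))//.
have := sqrtr_ge0 F; have := sqr_sqrtr F0.
have := sqrtr_ge0 G; have := sqr_sqrtr G0.
move: (Num.sqrt F) (Num.sqrt G) => X Y <- Y0 <- X0.
have u0 : 0 <= X ^+ 2 + a ^+ 2 * w by rewrite addr_ge0 ?mulr_ge0 ?sqr_ge0// ltW.
have v0 : 0 <= Y ^+ 2 + b ^+ 2 * w by rewrite addr_ge0 ?mulr_ge0 ?sqr_ge0// ltW.
have key : X * Y + a * b * w <=
    Num.sqrt (X ^+ 2 + a ^+ 2 * w) * Num.sqrt (Y ^+ 2 + b ^+ 2 * w).
  rewrite -sqrtrM// -[leLHS]ger0_norm; last first.
    by rewrite addr_ge0 ?mulr_ge0// ltW.
  rewrite -sqrtr_sqr ler_sqrt ?mulr_ge0//.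
  rewrite -subr_ge0 (_ : _ - _ = w * (X * b - Y * a) ^+ 2); last by ring.
  by rewrite mulr_ge0 ?sqr_ge0// ltW.
rewrite [leRHS]sqrrD !sqr_sqrtr// -mulr_natr.
rewrite -subr_ge0; set q := Num.sqrt _ * Num.sqrt _ in key *.
rewrite (_ : _ - _ = 2 * (q - (X * Y + a * b * w))); last by ring.
by rewrite mulr_ge0// subr_ge0.
Qed.

Lemma weighted_termsZ a f :
  weighted_terms (a *: f) = complex.Re `|a| ^+ 2 *: weighted_terms f.
Proof.
by apply/funext => n; rewrite /weighted_terms rnormZ exprMn -mulrA.
Qed.

Lemma weighted_series_le f n :
  cvgn (series (weighted_terms f)) ->
  series (weighted_terms f) n <= limn (series (weighted_terms f)).
Proof. by move=> cf; exact: nondecreasing_cvgn_le (weighted_series_nd f) cf n. Qed.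

Lemma weighted_series_leD f g n :
  cvgn (series (weighted_terms f)) -> cvgn (series (weighted_terms g)) ->
  series (weighted_terms (f + g)) n <=
  (Num.sqrt (limn (series (weighted_terms f))) +
   Num.sqrt (limn (series (weighted_terms g)))) ^+ 2.
Proof.
move=> cf cg; apply: le_trans (weighted_seriesD f g n) _.
rewrite ler_sqr ?nnegrE ?addr_ge0 ?sqrtr_ge0// lerD//.
  by rewrite ler_wsqrtr// weighted_series_le.
by rewrite ler_wsqrtr// weighted_series_le.
Qed.

Lemma weighted_submod : submod_closed weighted_pred.
Proof.
split=> [|a f g].
  apply/asboolP; rewrite (_ : weighted_terms 0 = 0).
    rewrite (_ : series 0 = cst 0); first exact: is_cvg_cst.
    by apply/funext => n; rewrite /series/= big1.
  apply/funext => n; rewrite /weighted_terms /rnorm normr0/=.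
  by rewrite expr0n mul0r.
move=> /asboolP cf /asboolP cg; apply/asboolP.
apply: nondecreasing_is_cvgn; first exact: weighted_series_nd.
have caf : cvgn (series (weighted_terms (a *: f))).
  by rewrite weighted_termsZ; exact: is_cvg_seriesZ.
eexists; move=> _ [n _ <-]; exact: (weighted_series_leD n caf cg).
Qed.

HB.instance Definition _ := GRing.isSubmodClosed.Build _ _
  weighted_pred weighted_submod.
HB.instance Definition _ := [SubChoice_isSubLmodule of weighted_space by <:].

Definition weighted_norm (f : weighted_space) : R :=
  Num.sqrt (limn (series (weighted_terms f))).

Let norm (f : weighted_space) : R[i] := (weighted_norm f)%:C.

Let cvg_terms (f : weighted_space) : cvgn (series (weighted_terms f)).
Proof. exact: asboolW (coefsP f). Qed.

Lemma coefsD (f g : weighted_space) : coefs (f + g) = coefs f + coefs g.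
Proof. exact: (raddfD (\val : weighted_space -> nat -> E)). Qed.

Lemma coefsZ a (f : weighted_space) : coefs (a *: f) = a *: coefs f.
Proof. exact: (linearZ_LR (\val : weighted_space -> nat -> E)). Qed.

Let normD (f g : weighted_space) : norm (f + g) <= norm f + norm g.
Proof.
rewrite /norm -rmorphD lecR /weighted_norm.
rewrite -[leRHS]ger0_norm ?addr_ge0 ?sqrtr_ge0// -sqrtr_sqr ler_wsqrtr//.
apply: limr_le; first exact: cvg_terms.
apply: nearW => n; rewrite coefsD.
exact: (weighted_series_leD n (@cvg_terms f) (@cvg_terms g)).
Qed.

Let normZ a (f : weighted_space) : norm (a *: f) = `|a| * norm f.
Proof.
rewrite /norm /weighted_norm coefsZ weighted_termsZ.
rewrite lim_seriesZ; last exact: cvg_terms.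
have a0 : 0 <= complex.Re `|a| by rewrite -lecR RRe_real ?ger0_real ?normr_ge0.
rewrite sqrtrM ?sqr_ge0// sqrtr_sqr ger0_norm// rmorphM.
by congr (_ * _); rewrite RRe_real ?ger0_real.
Qed.

Let norm0_eq0 (f : weighted_space) : norm f = 0 -> f = 0.
Proof.
move=> /complexI/eqP; rewrite sqrtr_eq0 => f0.
apply: val_inj; apply/funext => n /=.
have : weighted_terms f n <= 0.
  apply: le_trans f0; apply: le_trans (weighted_series_le n.+1 (@cvg_terms f)).
  rewrite /series/= big_nat_recr//= lerDr.
  by apply: sumr_ge0 => i _; exact: weighted_terms_ge0.
rewrite pmulr_lle0// => fn0.
have /eqP : rnorm (f n) ^+ 2 = 0 by apply/eqP; rewrite eq_le fn0 sqr_ge0.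
by rewrite sqrf_eq0 => /eqP fn; apply/normr0_eq0; rewrite -rnormE fn.
Qed.

HB.instance Definition _ :=
  Lmodule_isNormed.Build R[i] weighted_space normD normZ norm0_eq0.

Lemma weighted_space_normE (f : weighted_space) :
  `|f| = (Num.sqrt (limn (series (fun n => rnorm (f n) ^+ 2 * (k n)%:num))))%:C.
Proof. by []. Qed.

(* B_k (x) I_E.  The shifted series need not have finite norm for an arbitrary
   weight k, in which case the value is 0. *)
Definition backward_shift (f : weighted_space) : weighted_space :=
  insubd 0 (fun n => f n.+1).

End WeightedSpace.

(* The backward shift maps the space into itself and is bounded there. *)
Definition backward_shift_bounded (R : realType) (k : nat -> {posnum R})
    (E : normedModType R[i]) :=
  (forall (f : weighted_space k E) n, backward_shift f n = f n.+1) /\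
  exists B : 'L(weighted_space k E), B =1 @backward_shift R k E.

Section Parts.
Variables (R : realType) (V : normedModType R[i]).

Definition invariant (S : V -> V) (M : closed_subspace V) :=
  {homo S : x / (M : set V) x}.

Lemma part_subproof (S : V -> V) (M : closed_subspace V) (x : subspace_type M) :
  invariant S M -> subspace_pred M (S x).
Proof. by move=> SM; apply: mem_set; apply: SM; exact: set_mem (valP x). Qed.

Definition part (S : V -> V) (M : closed_subspace V) (SM : invariant S M)
  (x : subspace_type M) : subspace_type M := SubspaceElt (part_subproof x SM).

End Parts.

(* A unitary operator is a surjective linear isometry. *)
Definition unitarily_equivalent (R : realType) (V W : normedModType R[i])
    (S : V -> V) (T : W -> W) :=
  exists U : {linear V -> W},
    [/\ bijective U, forall x, `|U x| = `|x| & forall x, U (S x) = T (U x)].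

Definition unitarily_equivalent_to_part (R : realType)
    (V W : normedModType R[i]) (S : V -> V) (T : W -> W) :=
  exists (M : closed_subspace W) (TM : invariant T M),
    unitarily_equivalent S (part TM).

Section HilbertOperators.
Variables (R : realType) (H : hilbertType R).
Implicit Types (A S T : 'L(H)) (c : R^nat).

(* The adjoint exists and is unique by the Riesz representation theorem. *)
Definition adjoint T : 'L(H) :=
  xget (bop0 H H) [set S : 'L(H) | forall x y, '[T x, y] = '[x, S y]].

Definition nonneg_operator A := forall x, 0 <= '[A x, x].

Definition operator_sqrt A : 'L(H) :=
  xget (bop0 H H) [set S : 'L(H) | nonneg_operator S /\ forall x, S (S x) = A x].

(* S is the sum of the series c_n T^*n T^n in the strong operator topology. *)
Definition hereditary_sum c T S :=
  forall x, series (fun n => (c n)%:C *: iter n (adjoint T) (iter n T x)) @ \oo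
    --> S x.

Definition hereditary_cvg c T := exists S : 'L(H), hereditary_sum c T S.

(* c(T^*, T) *)
Definition hereditary c T : 'L(H) :=
  xget (bop0 H H) [set S | hereditary_sum c T S].

Definition defect_operator c T : 'L(H) := operator_sqrt (hereditary c T).

Definition defect_space c T : hilbertType R :=
  subspace_type (range_closure (defect_operator c T)).

End HilbertOperators.

Section PowerSeries.
Variable R : realType.
Implicit Type a : R^nat.

(* Elements of the Wiener algebra with real Taylor coefficients are given by
   their coefficient sequences. *)
Definition wiener a := cvgn [normed series a].

Definition pseries_terms a (z : R[i]) : nat -> R[i]^o :=
  fun n => (a n)%:C * z ^+ n.

Definition pseries_sum a (z : R[i]) : R[i] := limn (series (pseries_terms a z)).

End PowerSeries.

(* Main.v *)
(* Write * for the Cauchy product of coefficient sequences, so that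
   alpha * k = delta_0.

   Everything rests on k * k <= C k and |alpha| <= C k, hence |alpha| * k <= C' k.
   The first bound is immediate from the tail and ratio conditions. For the
   second, cut alpha = a + b with a of finite support and b small in l^1; then
   u = b * k is small in l^1, satisfies |u| <= X k, and alpha = a + u * alpha.
   With r_n = rho^n for rho < 1 near 1, and g the restriction of k to indices
   n >= m, the weight w = r * (delta_0 + lambda g) satisfies |u| * w <= (3/4) w
   and w <= C k, so |alpha| <= C w follows by induction on the index.

   If T is a part of B_k (x) I and f_n are the coefficients of the image of x,
   then |T^m x|^2 = sum_j k_j |f_(m+j)|^2, so that
   sum_m c_m |T^m x|^2 = sum_n (c * k)_n |f_n|^2; this is O(|x|^2) for c = k and
   c = |alpha|, and equals |f_0|^2 >= 0 for c = alpha. Conversely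
   x |-> sum_n (D T^n x) t^n intertwines T with the shift, and is isometric as
   sum_n k_n |D T^n x|^2 = sum_N (k * alpha)_N |T^N x|^2 = |x|^2. *)
Require Import Defs.
From HB Require Import structures.
From mathcomp Require Import all_boot all_order all_algebra.
From mathcomp Require Import complex.
From mathcomp Require Import all_classical all_reals all_analysis.
From mathcomp Require Import ring lra zify.
Set Implicit Arguments.
Unset Strict Implicit.
Unset Printing Implicit Defensive.
Import Order.TTheory GRing.Theory Num.Theory numFieldNormedType.Exports.
Local Open Scope classical_set_scope.
Local Open Scope ring_scope.
Local Open Scope complex_scope.

(** * Cauchy products *)

Section Convolution.
Variable R : realType.
Implicit Types a b c F s u : R^nat.

Definition convol a b : R^nat := fun n => \sum_(i < n.+1) a i * b (n - i)%N.

Definition delta0 : R^nat := fun n => (n == 0%N)%:R.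

(** Truncating to polynomials lets commutativity and associativity of the Cauchy product be
    inherited from the polynomial ring. *)
Lemma convol_poly a b N n : (n < N)%N ->
  convol a b n = (\poly_(i < N) a i * \poly_(i < N) b i)`_n.
Proof.
move=> nN; rewrite coefM; apply: eq_bigr => i _; rewrite !coef_poly.
by rewrite (leq_ltn_trans _ nN) ?(leq_ltn_trans (leq_subr _ _))// -ltnS.
Qed.

Lemma convolC a b : convol a b = convol b a.
Proof. by apply/funext => n; rewrite !(@convol_poly _ _ n.+1)// mulrC. Qed.

Lemma convolA a b c : convol a (convol b c) = convol (convol a b) c.
Proof.
apply/funext => n.
transitivity ((\poly_(i < n.+1) a i *
  (\poly_(i < n.+1) b i * \poly_(i < n.+1) c i))`_n).
  rewrite coefM; apply: eq_bigr => i _.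
  by rewrite coef_poly ltn_ord (@convol_poly _ _ n.+1)// ltnS leq_subr.
rewrite mulrA coefM; apply: eq_bigr => i _.
by rewrite coef_poly ltnS leq_subr (@convol_poly _ _ n.+1).
Qed.

Lemma convol_delta0 a : convol delta0 a = a.
Proof.
apply/funext => n; rewrite /convol big_ord_recl subn0 mul1r.
rewrite big1 ?addr0// => i _.
by rewrite mul0r.
Qed.

Lemma convolDl a b c : convol (a + b) c = convol a c + convol b c.
Proof.
apply/funext => n; rewrite -[RHS]/(convol a c n + convol b c n) -big_split/=.
by apply: eq_bigr => i _; rewrite mulrDl.
Qed.

Lemma convolZl x a b : convol (x *: a) b = x *: convol a b.
Proof.
apply/funext => n; rewrite -[RHS]/(x * convol a b n) mulr_sumr.
by apply: eq_bigr => i _; rewrite mulrA.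
Qed.

Lemma convol_le a b c d : (forall n, 0 <= a n) -> (forall n, 0 <= d n) ->
  (forall n, a n <= c n) -> (forall n, b n <= d n) ->
  forall n, convol a b n <= convol c d n.
Proof.
move=> a0 d0 ac bd n; apply: ler_sum => i _.
rewrite (@le_trans _ _ (a i * d (n - i)%N))//; first by rewrite ler_wpM2l.
by rewrite ler_wpM2r.
Qed.

Lemma convol_ge0 a b : (forall n, 0 <= a n) -> (forall n, 0 <= b n) ->
  forall n, 0 <= convol a b n.
Proof. by move=> a0 b0 n; apply: sumr_ge0 => i _; rewrite mulr_ge0. Qed.

Lemma normr_convol a b n :
  `|convol a b n| <= convol (fun n => `|a n|) (fun n => `|b n|) n.
Proof.
apply: le_trans (ler_norm_sum _ _ _) _.
by apply: ler_sum => i _; rewrite normrM.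
Qed.

(** Both sides run over the pairs with i + j < M, by diagonals on the left and by rows on the
    right. *)
Lemma sum_triangle (V : nmodType) (G : nat -> nat -> V) M :
  \sum_(m < M) \sum_(i < m.+1) G i (m - i)%N =
  \sum_(i < M) \sum_(j < M - i) G i j.
Proof.
elim: M => [|M ih]; first by rewrite !big_ord0.
rewrite big_ord_recr/= ih [RHS]big_ord_recr/= subSn// subnn big_ord1.
rewrite big_ord_recr/= subnn addrA; congr (_ + _); rewrite -big_split/=.
by apply: eq_bigr => i _; rewrite subSn 1?ltnW// [RHS]big_ord_recr.
Qed.

(** The triangle i + j < N lies in the square of side N. *)
Lemma sum_convol_le a b N : (forall n, 0 <= a n) -> (forall n, 0 <= b n) ->
  \sum_(m < N) convol a b m <= (\sum_(i < N) a i) * \sum_(j < N) b j.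
Proof.
move=> a0 b0; rewrite (sum_triangle (fun i j : nat => a i * b j)) mulr_suml.
apply: ler_sum => i _; rewrite mulr_sumr.
rewrite -!(big_mkord xpredT (fun j : nat => a i * b j)).
rewrite [leRHS](@big_cat_nat _ _ _ (N - i))//= ?leq_subr//.
by rewrite lerDl sumr_ge0// => j _; rewrite mulr_ge0.
Qed.

Lemma cvg_sum_ord N (P : pred 'I_N) (f : 'I_N -> R^nat) (l : 'I_N -> R) :
  (forall i, P i -> f i @ \oo --> l i) ->
  (fun n => \sum_(i | P i) f i n) @ \oo --> \sum_(i | P i) l i.
Proof.
by move=> fl; apply: cvg_big => //; exact: add_continuous.
Qed.

(* With F_m = x^m this is Mertens' theorem; with F_m = |T^m x|^2 it evaluates
   double hereditary sums. *)
Lemma cvg_series_convol a b F s :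
  (forall n, series (fun j => b j * F (n + j)%N) @ \oo --> s n) ->
  cvgn (series (fun m =>
    convol (fun n => `|a n|) (fun n => `|b n|) m * `|F m|)) ->
  (fun N => series (fun n => a n * s n) N -
            series (fun m => convol a b m * F m) N) @ \oo --> 0.
Proof.
move=> bs; set C := (fun m : nat => _) => cC.
pose L := limn (series C).
have C0 n : 0 <= C n by rewrite mulr_ge0// convol_ge0.
have ndC : nondecreasing_seq (series C) by exact: nondecreasing_series.
pose A n j := `|a n| * `|b j| * `|F (n + j)%N|.
have CA n : C n = \sum_(i < n.+1) A i (n - i)%N.
  rewrite /C /convol mulr_suml; apply: eq_bigr => i _.
  by rewrite /A subnKC// -ltnS.
(* The difference collects the pairs with i < N <= i + j, so it is at most the tail of the
   absolutely convergent double series. *)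
have key N : `|series (fun n => a n * s n) N -
            series (fun m => convol a b m * F m) N| <= L - series C N.
  have -> : series (fun m => convol a b m * F m) N =
      \sum_(i < N) a i * \sum_(j < N - i) b j * F (i + j)%N.
    under [RHS]eq_bigr do rewrite mulr_sumr.
    rewrite -(sum_triangle (fun i j : nat => a i * (b j * F (i + j)%N))).
    rewrite seriesEord; apply: eq_bigr => n _; rewrite /convol mulr_suml.
    apply: eq_bigr => i _.
    by rewrite subnKC -1?ltnS ?mulrA.
  rewrite seriesEord/= -sumrB.
  (* The i-th inner series is cut at J + (N - i), so that every pair kept lies in the triangle i + j
     < J + N, whose total is a partial sum of [C]. *)
  pose f J := `|\sum_(i < N) (a i * (\sum_(j < J + (N - i)) b j * F (i + j)%N)
       - a i * (\sum_(j < N - i) b j * F (i + j)%N))|.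
  have fl : f @ \oo --> `|\sum_(i < N) (a i * s i -
      a i * (\sum_(j < N - i) b j * F (i + j)%N))|.
    apply: cvg_norm; apply: (@cvg_sum_ord _ xpredT (fun (i : 'I_N) J =>
      a i * (\sum_(j < J + (N - i)) b j * F (i + j)%N) -
      a i * (\sum_(j < N - i) b j * F (i + j)%N))) => i _.
    apply: cvgB; last exact: cvg_cst.
    apply: cvgMl_tmp.
    move/(_ i): bs; rewrite -(cvg_shiftn (N - i)); apply: cvg_trans.
    by apply: near_eq_cvg; apply: nearW => J /=; rewrite seriesEord.
  apply: (ler_cvg_to fl (cvg_cst (L - series C N))); apply: nearW => J.
  rewrite /f/=.
  have CL : series C (J + N)%N <= L by exact: nondecreasing_cvgn_le ndC cC _.
  apply: le_trans (lerB CL (lexx (series C N))).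
  have CE M : series C M = \sum_(i < M) \sum_(j < M - i) A i j.
    by rewrite seriesEord/= -sum_triangle; apply: eq_bigr => n _; exact: CA.
  rewrite !CE; apply: le_trans (ler_norm_sum _ _ _) _.
  rewrite -(big_mkord xpredT (fun i : nat => \sum_(j < J + N - i) A i j)).
  rewrite (@big_cat_nat _ _ _ N)//= ?leq_addl// addrAC big_mkord -sumrB.
  rewrite -[leLHS]addr0 lerD//; last first.
    by apply: sumr_ge0 => i _; apply: sumr_ge0 => j _; rewrite /A !mulr_ge0.
  apply: ler_sum => i _; rewrite -mulrBr -(addnBA _ (ltnW (ltn_ord i))).
  rewrite -!(big_mkord xpredT (fun j : nat => b j * F (i + j)%N)).
  rewrite -!(big_mkord xpredT (A i)).
  rewrite !(@big_cat_nat _ _ _ (N - i) 0%N (J + (N - i))) ?leq_addl//=.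
  rewrite !(addrAC _ _ (- _)) !subrr !add0r normrM.
  apply: le_trans (ler_wpM2l (normr_ge0 _) (ler_norm_sum _ _ _)) _.
  by rewrite mulr_sumr ler_sum// => j _; rewrite /A normrM mulrA.
apply/cvgr0Pnorm_le => e e0.
have := cC => /cvgrPdist_le/(_ e e0); apply: filterS => N.
apply: le_trans; apply: le_trans (key N) _.
by rewrite ler_norm.
Qed.
End Convolution.

(** * Coefficient bounds for the reciprocal *)

Section InverseBound.
Variable R : realType.
Implicit Types a b u x w : R^nat.

(** The summand is invariant under i -> n - i, which folds the upper half onto the lower one; the
    middle term may be counted twice. *)
Lemma convol_half x n : (forall n, 0 <= x n) ->
  convol x x n <= 2 * \sum_(0 <= i < n./2.+1) x i * x (n - i)%N.
Proof.
move=> x0; pose h i := x i * x (n - i)%N.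
have h0 i : 0 <= h i by rewrite mulr_ge0.
have -> : \sum_(0 <= i < n./2.+1) h i = \sum_(i < n.+1 | (i < n./2.+1)%N) h i.
  by rewrite big_mkord -big_ord_widen//; lia.
rewrite mulr_natl mulr2n big_mkcond/= [X in _ + X](reindex_inj rev_ord_inj)/=.
rewrite -big_split/=.
apply: ler_sum => i _.
have ni : (i <= n)%N by rewrite -ltnS.
rewrite !subSS.
have -> : h (n - i)%N = h i by rewrite /h subKn// mulrC.
rewrite !ltnS.
have [_|] := leqP i n./2; first by rewrite lerDl; case: ifP.
by move=> i2; rewrite ifT ?add0r// leq_subLR; lia.
Qed.

Lemma finite_bound a w M : (forall n, 0 < w n) ->
  exists2 C, 0 <= C & forall n, (n < M)%N -> `|a n| <= C * w n.
Proof.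
(* Each quotient is a single term of this sum of nonnegative terms. *)
move=> w0; exists (\sum_(i < M) `|a i| / w i) => [|n nM].
  by apply: sumr_ge0 => i _; rewrite divr_ge0// ltW.
rewrite -ler_pdivrMr// (bigD1 (Ordinal nM))//= lerDl.
by apply: sumr_ge0 => i _; rewrite divr_ge0// ltW.
Qed.

Lemma bernoulli_le (y : R) m : 0 <= y <= 1 -> 1 - m%:R * y <= (1 - y) ^+ m.
Proof.
move=> /andP[y0 y1]; elim: m => [|m ih]; first by rewrite mul0r subr0.
rewrite exprS; apply: (@le_trans _ _ ((1 - y) * (1 - m%:R * y))); last first.
  by rewrite ler_wpM2l// subr_ge0.
rewrite -natr1 -subr_ge0.
by rewrite (_ : _ - _ = m%:R * y ^+ 2) ?mulr_ge0 ?sqr_ge0//; ring.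
Qed.

Lemma nondecreasing_sum_ord u : (forall n, 0 <= u n) ->
  nondecreasing_seq (fun N => \sum_(n < N) u n).
Proof.
move=> u0; rewrite -[X in nondecreasing_seq X](seriesEord u).
exact: nondecreasing_series.
Qed.

Lemma sum_le_lim u N : (forall n, 0 <= u n) -> cvgn (series u) ->
  \sum_(i < N) u i <= limn (series u).
Proof.
move=> u0 cu; rewrite -(big_mkord xpredT u).
by apply: nondecreasing_cvgn_le => //; exact: nondecreasing_series.
Qed.

Lemma series_small_tail u e :
  (forall n, 0 <= u n) -> cvgn (series u) -> 0 < e ->
  exists2 M, (0 < M)%N & forall N, \sum_(M <= i < N) u i <= e.
Proof.
move=> u0 cu e0; have /cvgrPdist_le/(_ _ e0)[M _ aM] := cu.
exists M.+1 => // N; have [MN|NM] := leqP M.+1 N; last first.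
  by rewrite big_geq ?ltW//; lia.
have := sum_le_lim N u0 cu.
have := aM M.+1 (leqnSn _); rewrite /series/= => /ler_normlW.
rewrite -(big_mkord xpredT u) (@big_cat_nat _ _ _ M.+1 0%N N)//=; lra.
Qed.

Variable k : R^nat.
Hypothesis k_gt0 : forall n, 0 < k n.
Hypothesis k_tail : forall e, 0 < e -> exists m, forall n, (2 * m <= n)%N ->
  \sum_(m <= j < n./2.+1) k j * k (n - j)%N <= e * k n.

Let k_ge0 n : 0 <= k n. Proof. exact: ltW. Qed.

(** In the folded sum, indices i < m are controlled by the ratio bound k_(n-i) <= C^i k_n, and
    indices i >= m by the tail condition with e = 1. *)
Lemma convol_self_bound (C : R) : (forall n, k n <= C * k n.+1) ->
  exists2 D, 0 < D & forall n, convol k k n <= D * k n.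
Proof.
move=> kC.
have C0 : 0 < C by have := lt_le_trans (k_gt0 0) (kC 0%N); rewrite pmulr_lgt0.
have kCi i n : (i <= n)%N -> k (n - i)%N <= C ^+ i * k n.
  elim: i n => [n _|i ih [//|n] iN]; first by rewrite subn0 mul1r.
  rewrite subSS (le_trans (ih _ _))// exprSr -mulrA ler_wpM2l//.
  by rewrite exprn_ge0// ltW.
have [m km] := k_tail ltr01.
pose S := \sum_(0 <= i < m) k i * C ^+ i.
have S0 : 0 <= S.
  by apply: sumr_ge0 => i _; rewrite mulr_ge0// exprn_ge0// ltW.
exists (2 * (S + 1)) => [|n]; first by rewrite mulr_gt0// ltr_wpDl.
rewrite (le_trans (convol_half _ k_ge0))// -mulrA ler_wpM2l//.
have term i : (i <= n)%N -> k i * k (n - i)%N <= k i * C ^+ i * k n.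
  by move=> iN; rewrite -mulrA ler_wpM2l// kCi.
have half_n i : (i < n./2.+1)%N -> (i <= n)%N.
  by lia.
have [nm|nm] := leqP (2 * m) n.
  rewrite (@big_cat_nat _ _ _ m)//=; last lia.
  rewrite mulrDl lerD ?km// /S mulr_suml ler_sum_nat// => i /andP[_ im].
  by apply: term; lia.
(* Here n < 2m, so every index up to n/2 is below m and the ratio bound suffices. *)
rewrite mulrDl (@le_trans _ _ (S * k n))//; last by rewrite lerDl mul1r.
rewrite /S mulr_suml [leRHS](@big_cat_nat _ _ _ n./2.+1)//=; last lia.
rewrite -[leLHS]addr0 lerD//.
  by rewrite ler_sum_nat// => i /andP[_ /half_n]; exact: term.
apply: sumr_ge0 => i _; rewrite !mulr_ge0// exprn_ge0// ltW//.
Qed.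

Let g m : R^nat := fun n => if (m <= n)%N then k n else 0.

Let g_ge0 m n : 0 <= g m n. Proof. by rewrite /g; case: ifP. Qed.

(** Below 2m one of the two indices is below m and the product vanishes; from 2m on, the folded sum
    is the one in the tail condition. *)
Let convol_g e m : 0 <= e -> (forall n, (2 * m <= n)%N ->
    \sum_(m <= j < n./2.+1) k j * k (n - j)%N <= e * k n) ->
  forall n, convol (g m) (g m) n <= 2 * e * g m n.
Proof.
move=> e0 km n; rewrite (le_trans (convol_half _ (@g_ge0 m)))// -mulrA.
rewrite ler_wpM2l//.
have [nm|nm] := leqP (2 * m) n; last first.
  rewrite big_nat big1 => [|i /andP[_ i2]]; first by rewrite mulr_ge0.
  by rewrite {1}/g ifF ?mul0r//; lia.
rewrite (@big_cat_nat _ _ _ m)//=; last lia.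
rewrite [X in X + _]big_nat [X in X + _]big1 ?add0r => [|i /andP[_ i2]].
  rewrite {3}/g ifT; last lia.
  apply: le_trans (km _ nm); apply: ler_sum => i _.
  by rewrite ler_pM// /g; case: ifP.
by rewrite {1}/g ifF ?mul0r//; lia.
Qed.

Hypothesis k_convol : exists2 D, 0 < D & forall n, convol k k n <= D * k n.
Hypothesis k_root : forall rho : R, 0 < rho < 1 ->
  exists2 C, 0 < C & forall n, rho ^+ n <= C * k n.
Hypothesis k_sum : cvgn (series k).

Lemma inverse_bound a : convol a k = delta0 R -> cvgn [normed series a] ->
  exists2 C, 0 < C & forall n, `|a n| <= C * k n.
Proof.
move=> ak a_sum; have [D D0 kD] := k_convol.
pose K := limn (series k).
have kK N : \sum_(i < N) k i <= K by exact: sum_le_lim.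
have K0 : 0 < K by apply: lt_le_trans (kK 1%N); rewrite big_ord1.
(* The threshold 1/(4K) makes the l^1 norm of u = b * k at most 1/4. *)
have [M M0 aM] : exists2 M, (0 < M)%N &
    forall N, \sum_(M <= i < N) `|a i| <= (4 * K)^-1.
  have K4 : 0 < (4 * K)^-1 by rewrite invr_gt0 mulr_gt0.
  exact: series_small_tail.
pose b : R^nat := fun n => if (n < M)%N then 0 else a n.
pose a' : R^nat := fun n => if (n < M)%N then a n else 0.
have aE : a = a' + b.
  by apply/funext => n; rewrite fctE /a' /b; case: ifP; rewrite ?addr0 ?add0r.
pose u := convol b k.
have ua : convol u a = b.
  by rewrite /u -convolA (convolC k) ak convolC convol_delta0.
(* This is why M is positive: (u * a)_n then involves a only at indices below n, and the final
   induction is well founded. *)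
have u0 : u 0%N = 0 by rewrite /u /convol big_ord1/= /b M0 mul0r.
have b_sum N : \sum_(i < N) `|b i| <= (4 * K)^-1.
  rewrite -(big_mkord xpredT (fun i : nat => `|b i|)).
  have [MN|NM] := leqP M N; last first.
    rewrite big_nat big1 => [|i iN]; first by rewrite invr_ge0 mulr_ge0// ltW.
    by rewrite /b ifT ?normr0//; lia.
  rewrite (@big_cat_nat _ _ _ M)//= [X in X + _]big_nat.
  rewrite [X in X + _]big1 ?add0r => [|i iM]; last first.
    by rewrite /b ifT ?normr0//; lia.
  rewrite (le_trans _ (aM N))// le_eqVlt; apply/orP; left; apply/eqP.
  by apply: eq_big_nat => i /andP[Mi _]; rewrite /b ltnNge Mi.
have u_sum N : \sum_(i < N) `|u i| <= 4^-1.
  have ule i : `|u i| <= convol (fun n => `|b n|) k i.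
    apply: le_trans (normr_convol _ _ _) _.
    by apply: convol_le => // n; rewrite ger0_norm.
  apply: (@le_trans _ _ (\sum_(i < N) convol (fun n => `|b n|) k i)).
    by apply: ler_sum.
  apply: le_trans (sum_convol_le _ _ k_ge0) _ => //.
  apply: le_trans (ler_pM _ _ (b_sum N) (kK N)) _; rewrite ?sumr_ge0//.
  by rewrite invfM -mulrA mulVf ?gt_eqF// mulr1.
have [C1 C10 a'1] := finite_bound a M k_gt0.
have a'k n : `|a' n| <= C1 * k n.
  by rewrite /a'; case: ifP => [/a'1//|_]; rewrite normr0 mulr_ge0.
pose C2 := (k 0%N)^-1.
have C20 : 0 < C2 by rewrite invr_gt0.
have dk n : delta0 R n <= C2 * k n.
  case: n => [|n]; first by rewrite mulVf ?gt_eqF.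
  by rewrite mulr_ge0// ltW.
(* From a = a' + b and a * k = delta_0 one gets u = delta_0 - a' * k; the two terms are at most C2 k
   and C1 (k * k). *)
pose X := C2 + C1 * D.
have X0 : 0 < X by rewrite ltr_wpDr// mulr_ge0// ltW.
have uX n : `|u n| <= X * k n.
  have -> : u n = delta0 R n - convol a' k n.
    by rewrite -ak {1}aE convolDl fctE addrAC subrr add0r.
  apply: le_trans (ler_normB _ _) _; rewrite mulrDl lerD//.
    by rewrite ger0_norm.
  apply: le_trans (normr_convol _ _ _) _.
  apply: (@le_trans _ _ (convol (C1 *: k) k n)).
    by apply: convol_le => // j; rewrite ger0_norm.
  by rewrite convolZl -mulrA; apply: ler_wpM2l.
(* With lambda = 8X, the choice of e gives 2 e lambda = 1, hence lambda (g * g) <= g, and g * z <=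
   2g + delta-free terms is avoided: g + lambda (g * g) <= 2g = lambda g / (4X), so X (g * z) <= z /
   4. *)
pose e := (16 * X)^-1.
have e0 : 0 < e by rewrite invr_gt0 mulr_gt0.
have [m /(convol_g (ltW e0)) gg] := k_tail e0.
pose lam := 8 * X.
have lam0 : 0 < lam by rewrite mulr_gt0.
(* Since m y <= 1/2, Bernoulli's inequality yields rho^m >= 1/2 for rho = 1 - y. *)
pose y := (2 * m.+1%:R : R)^-1.
have y0 : 0 < y by rewrite invr_gt0 mulr_gt0.
have m1 : 0 <= m%:R :> R by [].
have y1 : y <= 2^-1 by rewrite /y lef_pV2 ?posrE ?mulr_gt0// -natr1; lra.
pose rho := 1 - y.
have rho01 : 0 < rho < 1 by rewrite /rho; lra.
have /andP[rho0 rho1] := rho01.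
have rhom : 2^-1 <= rho ^+ m.
  apply: le_trans (bernoulli_le _ _); last lra.
  suff : m%:R * y <= 2^-1 by lra.
  rewrite /y invfM mulrCA ger_pMr ?invr_gt0// ler_pdivrMr// mul1r ler_nat.
  exact: leqnSn.
pose r : R^nat := fun n => rho ^+ n.
have r0 n : 0 <= r n by rewrite exprn_ge0// ltW.
pose z := delta0 R + lam *: g m.
have z0 n : 0 <= z n by rewrite addr_ge0 ?mulr_ge0// ltW.
pose w := convol r z.
have w0 n : 0 <= w n by exact: convol_ge0.
have wS n : w n.+1 = z n.+1 + rho * w n.
  rewrite /w /convol big_ord_recl/= mul1r; congr (_ + _); rewrite mulr_sumr.
  by apply: eq_bigr => i _; rewrite /r /= /bump/= add1n exprS mulrA.
have wi i n : (i <= n)%N -> rho ^+ i * w (n - i)%N <= w n.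
  elim: i n => [n _|i ih [//|n] iN]; first by rewrite subn0 mul1r.
  rewrite subSS exprS -mulrA wS.
  by rewrite (@le_trans _ _ (rho * w n)) ?lerDr// ler_wpM2l ?ih// ltW.
have rw n : r n <= w n.
  rewrite /w /convol big_ord_recr/= subnn -[leLHS]add0r lerD//.
    by apply: sumr_ge0 => i _; rewrite mulr_ge0.
  by rewrite ler_peMr// /z -[leRHS]/(1 + lam * g m 0%N) lerDl mulr_ge0// ltW.
(* For i < m, rho^i >= 1/2 gives w_(n-i) <= 2 w_n, so these terms contribute at most 2 (1/4) w_n.
   For i >= m, |u| <= X g contributes at most w_n / 4. *)
have uw n : convol (fun n => `|u n|) w n <= 3 / 4 * w n.
  pose ul : R^nat := fun n => if (n < m)%N then `|u n| else 0.
  have ulg i : `|u i| <= (ul + X *: g m) i.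
    rewrite /ul !fctE /g; case: ltnP => _; last by rewrite add0r.
    by rewrite scaler0 addr0.
  apply: (@le_trans _ _ (convol (ul + X *: g m) w n)).
    by apply: convol_le.
  rewrite convolDl convolZl -[leLHS]/(convol ul w n + X * convol (g m) w n).
  have -> : 3 / 4 * w n = 2^-1 * w n + 4^-1 * w n by lra.
  apply: lerD.
    apply: (@le_trans _ _ (\sum_(i < n.+1) 2 * `|u i| * w n)).
      apply: ler_sum => i _; rewrite /ul; case: ltnP => im; last first.
        by rewrite mul0r !mulr_ge0.
      rewrite -mulrA mulrCA ler_wpM2l// -ler_pdivrMl//.
      have iN : (i <= n)%N by rewrite -ltnS.
      apply: le_trans (wi _ _ iN); rewrite ler_wpM2r// (le_trans rhom)//.
      by rewrite ler_wiXn2l ?(ltW rho0) ?(ltW rho1)// ltnW.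
    rewrite -mulr_suml -mulr_sumr ler_wpM2r//.
    by have := u_sum n.+1; lra.
  have -> : convol (g m) w = convol r (convol (g m) z).
    by rewrite /w convolA (convolC (g m)) -convolA.
  apply: (@le_trans _ _ (X * convol r ((4 * X)^-1 *: z) n)).
    rewrite ler_wpM2l ?(ltW X0)//; apply: convol_le => // j.
      by rewrite mulr_ge0// invr_ge0 mulr_ge0// ltW.
    rewrite /z (convolC (g m)) convolDl convol_delta0 convolZl.
    rewrite -[leLHS]/(g m j + lam * convol (g m) (g m) j).
    rewrite -[leRHS]/((4 * X)^-1 * (delta0 R j + lam * g m j)).
    have lamg : lam * convol (g m) (g m) j <= g m j.
      rewrite (le_trans (ler_wpM2l (ltW lam0) (gg j)))//.
      rewrite /lam /e le_eqVlt; apply/orP; left; apply/eqP.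
      by field; rewrite gt_eqF.
    have Xlam : (4 * X)^-1 * (lam * g m j) = 2 * g m j.
      by rewrite /lam; field; rewrite gt_eqF.
    rewrite mulrDr Xlam; have : 0 <= (4 * X)^-1 * delta0 R j.
      by rewrite mulr_ge0// invr_ge0 mulr_ge0// ltW.
    lra.
  rewrite convolC convolZl convolC -[leLHS]/(X * ((4 * X)^-1 * w n)).
  by rewrite mulrA invfM mulrCA divff ?gt_eqF// mulr1.
have [C3 C30 a'3] := finite_bound a M (fun n => exprn_gt0 n rho0).
(* The constant solves C3 + (3/4) c = c, as required by the recursion a = a' + u * a. *)
have aw n : `|a n| <= 4 * C3 * w n.
  have a'w j : `|a' j| <= C3 * w j.
    rewrite /a'; case: ifP => [/a'3 /le_trans|_].
      by apply; rewrite ler_wpM2l// rw.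
    by rewrite normr0 mulr_ge0.
  elim/ltn_ind: n => n ih.
  rewrite aE -[X in `|X|]/(a' n + b n) -ua.
  apply: le_trans (ler_normD _ _) _.
  have -> : 4 * C3 * w n = C3 * w n + 4 * C3 * (3 / 4 * w n) by lra.
  apply: lerD => //; apply: le_trans (normr_convol _ _ _) _.
  apply: (@le_trans _ _ (4 * C3 * convol (fun n => `|u n|) w n)); last first.
    by rewrite ler_wpM2l// mulr_ge0.
  rewrite /convol mulr_sumr; apply: ler_sum => -[[|i] iN] _ /=.
    by rewrite u0 normr0 !mul0r mulr0.
  rewrite mulrCA ler_wpM2l//; apply: ih; move: iN; clear; lia.
have [Cr Cr0 rk] := k_root rho01.
(* Both factors of w = r * z are multiples of k at most, and k * k <= D k. *)
have wk n : w n <= Cr * (C2 + lam) * D * k n.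
  have zk j : z j <= ((C2 + lam) *: k) j.
    rewrite /z -[leLHS]/(delta0 R j + lam * g m j) -[leRHS]/((C2 + lam) * k j).
    rewrite mulrDl lerD// ler_wpM2l ?(ltW lam0)// /g.
    by case: ifP.
  have C2l0 : 0 < C2 + lam by rewrite addr_gt0.
  apply: (@le_trans _ _ (convol (Cr *: k) ((C2 + lam) *: k) n)).
    apply: convol_le => // j; rewrite mulr_ge0// ltW//.
  rewrite convolZl convolC convolZl -[leLHS]/(Cr * ((C2 + lam) * convol k k n)).
  by rewrite -!mulrA ler_wpM2l ?(ltW Cr0)// ler_wpM2l ?(ltW C2l0).
(* The added 1 ensures strict positivity, as C3 may be 0. *)
exists (4 * C3 * (Cr * (C2 + lam) * D) + 1) => [|n].
  have C2l0 : 0 < C2 + lam by rewrite addr_gt0.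
  by rewrite ltr_wpDl// mulr_ge0// ?mulr_ge0// ?(ltW Cr0) ?(ltW D0) ?(ltW C2l0).
rewrite (le_trans (aw n))//.
rewrite (@le_trans _ _ (4 * C3 * (Cr * (C2 + lam) * D) * k n))//.
  by rewrite -[leRHS]mulrA ler_wpM2l ?mulr_ge0.
by rewrite ler_wpM2r// lerDl.
Qed.
End InverseBound.

(** * From pointwise reciprocals to an identity of coefficients *)

Section CauchyInverse.
Variable R : realType.
Implicit Types a b u : R^nat.

Lemma cvg_real_complex (u : R^nat) (l : R) : u @ \oo --> l ->
  (fun n => (u n)%:C : R[i]^o) @ \oo --> (l%:C : R[i]^o).
Proof.
move=> ul; apply/cvgrPdist_lt => e e0.
have re : e = (complex.Re e)%:C by rewrite RRe_real// gtr0_real.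
have e1 : 0 < complex.Re e by rewrite -ltcR -re.
move/cvgrPdist_lt : ul => /(_ _ e1); apply: filterS => n.
by rewrite re -rmorphB/= normc_def/= expr0n addr0 sqrtr_sqr ltcR.
Qed.

Lemma pseries_sum_real a (x : R) : cvgn (series (fun n => a n * x ^+ n)) ->
  pseries_sum a x%:C = (limn (series (fun n => a n * x ^+ n)))%:C.
Proof.
move=> ca; rewrite /pseries_sum; apply: (@cvg_lim R[i]^o).
  exact: norm_hausdorff.
have -> : series (pseries_terms a x%:C) =
    fun n => (series (fun n => a n * x ^+ n) n)%:C.
  apply/funext => n; rewrite /series/= rmorph_sum; apply: eq_bigr => i _.
  by rewrite /pseries_terms rmorphM rmorphXn.
exact: cvg_real_complex.
Qed.

Lemma wiener_cvg_at a (x : R) : wiener a -> 0 <= x <= 1 ->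
  cvgn (series (fun n => a n * x ^+ n)).
Proof.
move=> wa /andP[x0 x1]; apply: normed_cvg.
apply: (@series_le_cvg _ _ (fun n => `|a n|)) => // n.
  exact: normr_ge0.
by rewrite /= normrM ler_piMr// normrX ger0_norm// exprn_ile1.
Qed.

Lemma wiener_convol a b : wiener a -> wiener b ->
  cvgn (series (convol (fun n => `|a n|) (fun n => `|b n|))).
Proof.
move=> wa wb; apply: nondecreasing_is_cvgn.
  by apply: nondecreasing_series => n _ _; exact: convol_ge0.
exists (limn [normed series a] * limn [normed series b]) => _ [n _ <-].
rewrite seriesEord (le_trans (sum_convol_le _ _ _))//.
apply: ler_pM; rewrite ?sumr_ge0//.
  exact: (@sum_le_lim _ (fun n => `|a n|)).
exact: (@sum_le_lim _ (fun n => `|b n|)).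
Qed.

(** By strong induction the series starts at c_n x^n, and the remaining terms are at most x^(n+1)
    times the l^1 norm. Dividing by x^n and taking x small forces c_n = 0. *)
Lemma coef_eq0_of_pseries c : wiener c ->
  (forall x : R, 0 < x < 1 ->
    series (fun n => c n * x ^+ n) @ \oo --> (0 : R)) ->
  forall n, c n = 0.
Proof.
move=> wc c0; elim/ltn_ind => n ih.
pose K := limn [normed series c].
have K0 : 0 <= K.
  by apply: le_trans (@sum_le_lim _ (fun n => `|c n|) 0 _ wc); rewrite ?big_ord0.
have key x : 0 < x < 1 -> `|c n| <= x * K.
  move=> /[dup] x01 /andP[x0 x1].
  suff : `|c n * x ^+ n| <= x ^+ n * (x * K).
    by rewrite normrM mulrC normrX (gtr0_norm x0) ler_pM2l// exprn_gt0.
  have cx : (fun N => `|series (fun n => c n * x ^+ n) N - c n * x ^+ n|) @ \oo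
      --> `|0 - c n * x ^+ n|.
    by apply: cvg_norm; apply: cvgB; [exact: c0|exact: cvg_cst].
  rewrite -normrN -[- _]add0r; apply: (ler_cvg_to cx (cvg_cst _)).
  exists n.+1 => // N /= nN.
  rewrite /series/= (@big_cat_nat _ _ _ n.+1)//= big_nat_recr//=.
  rewrite big_nat big1 => [|i /andP[_ /ih ->]]; last by rewrite mul0r.
  rewrite add0r addrAC subrr add0r (le_trans (ler_norm_sum _ _ _))//.
  apply: (@le_trans _ _ (x ^+ n.+1 * \sum_(n.+1 <= i < N) `|c i|)).
    rewrite mulr_sumr !big_nat; apply: ler_sum => i /andP[ni _].
    rewrite normrM mulrC ler_wpM2r// normrX (gtr0_norm x0).
    by rewrite ler_wiXn2l// ltW.
  rewrite mulrA -exprSr ler_wpM2l ?exprn_ge0 ?(ltW x0)//.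
  apply: le_trans (@sum_le_lim _ (fun n => `|c n|) N _ wc) => //.
  rewrite -(big_mkord xpredT (fun n => `|c n|)).
  rewrite [leRHS](@big_cat_nat _ _ _ n.+1)//=.
  by rewrite lerDr sumr_ge0.
apply/eqP; rewrite -normr_le0 leNgt; apply/negP => cn0.
(* Chosen so that x < 1 and x K < |c_n|, contradicting [key]. *)
pose x := `|c n| / (2 * (K + `|c n|)).
have d0 : 0 < 2 * (K + `|c n|) by rewrite mulr_gt0// ltr_wpDl.
have /key : 0 < x < 1.
  by rewrite divr_gt0//= ltr_pdivrMr// mul1r; lra.
rewrite /x mulrAC ler_pdivlMr// -subr_le0.
rewrite (_ : _ - _ = `|c n| * (K + 2 * `|c n|)); last by ring.
by rewrite leNgt mulr_gt0// ltr_wpDl// mulr_gt0.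
Qed.

(** At a real point 0 < x < 1, Mertens' theorem sums the Cauchy product to the product of the two
    values, which is 1; uniqueness of coefficients then gives delta_0. *)
Lemma convol_inverse a b : wiener a -> wiener b ->
  (forall z : R[i], `|z| < 1 -> pseries_sum a z != 0) ->
  (forall z : R[i], `|z| < 1 -> pseries_sum b z = (pseries_sum a z)^-1) ->
  convol a b = delta0 R.
Proof.
move=> wa wb a0 ba.
have wab := wiener_convol wa wb.
apply/funext => n; apply/eqP; rewrite -subr_eq0; apply/eqP.
pose c n := convol a b n - delta0 R n; rewrite -/(c n).
apply: (@coef_eq0_of_pseries c).
  have wd : wiener (delta0 R).
    apply/cvg_ex; exists 1; apply: cvg_near_cst; exists 1%N => // -[//|N] _.
    rewrite -[LHS]/(\sum_(0 <= i < N.+1) `|delta0 R i|).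
    rewrite big_nat_recl// /delta0/= normr1 big1 ?addr0// => i _.
    by rewrite normr0.
  apply: (@series_le_cvg _ _
    (convol (fun n => `|a n|) (fun n => `|b n|) +
     (fun n => `|delta0 R n|))) => //.
  - by move=> m; exact: normr_ge0.
  - by move=> m; apply: addr_ge0; [exact: convol_ge0|exact: normr_ge0].
  - move=> m; rewrite /=/c (le_trans (ler_normB _ _))//.
    by apply: lerD => //; exact: normr_convol.
  - exact: is_cvg_seriesD.
move=> x /andP[x0 x1]; have x01 : 0 <= x <= 1 by rewrite !ltW.
have ca := wiener_cvg_at wa x01; have cb := wiener_cvg_at wb x01.
have xC : `|x%:C| < 1 :> R[i].
  by rewrite normc_def/= expr0n addr0 sqrtr_sqr gtr0_norm// ltcR.
pose A := limn (series (fun n => a n * x ^+ n)).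
pose B := limn (series (fun n => b n * x ^+ n)).
have AB : A * B = 1.
  apply: (@complexI R); rewrite rmorphM/= -!pseries_sum_real// ba// mulfV//.
  exact: a0.
have := @cvg_series_convol _ a b (fun n => x ^+ n) (fun n => x ^+ n * B).
have bs m : series (fun j => b j * x ^+ (m + j)) @ \oo --> x ^+ m * B.
  have -> : series (fun j => b j * x ^+ (m + j)) =
      fun N => x ^+ m * series (fun n => b n * x ^+ n) N.
    apply/funext => N; rewrite /series/= mulr_sumr; apply: eq_bigr => i _.
    by rewrite exprD mulrCA.
  exact: cvgMl_tmp.
move=> /(_ bs) H.
have /H {}H : cvgn (series (fun m =>
    convol (fun n => `|a n|) (fun n => `|b n|) m * `|x ^+ m|)).
  apply: (@series_le_cvg _ _ (convol (fun n => `|a n|) (fun n => `|b n|))) => //.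
  - by move=> m; rewrite mulr_ge0// convol_ge0.
  - by move=> m; exact: convol_ge0.
  - move=> m; rewrite ler_piMr ?convol_ge0// ger0_norm ?exprn_ge0 ?(ltW x0)//.
    by rewrite exprn_ile1// ltW.
have aB : series (fun n => a n * (x ^+ n * B)) @ \oo --> (1 : R).
  have -> : series (fun n => a n * (x ^+ n * B)) =
      fun N => series (fun n => a n * x ^+ n) N * B.
    apply/funext => N; rewrite /series/= mulr_suml; apply: eq_bigr => i _.
    by rewrite mulrA.
  by rewrite -AB; exact: cvgMr_tmp.
have {}H : series (fun m => convol a b m * x ^+ m) @ \oo --> (1 : R).
  rewrite -(subr0 1).
  rewrite (_ : series _ = (fun N => series (fun n => a n * (x ^+ n * B)) N
    - (series (fun n => a n * (x ^+ n * B)) N -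
       series (fun m => convol a b m * x ^+ m) N))); first exact: cvgB.
  by apply/funext => N; rewrite subKr.
(* After a shift by one every partial sum contains the index 0, so delta_0 contributes exactly the
   constant 1. *)
rewrite -(subrr (1 : R)) -cvg_shiftS.
rewrite (_ : [sequence _]_n =
  (fun N => series (fun m => convol a b m * x ^+ m) N.+1 - 1)).
  by apply: cvgB; [rewrite cvg_shiftS|exact: cvg_cst].
apply/funext => N /=.
rewrite /c -[LHS]/(\sum_(0 <= j < N.+1) (convol a b j - delta0 R j) * x ^+ j).
under eq_bigr do rewrite mulrBl.
rewrite sumrB; congr (_ - _); rewrite big_nat_recl// big1 => [|i _].
  by rewrite addr0 mulr1.
by rewrite /delta0/= mul0r.
Qed.

End CauchyInverse.

(** * The hypotheses on the weight as explicit inequalities *)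

Section WeightHypotheses.
Variables (R : realType) (k : R^nat).
Hypothesis k_gt0 : forall n, 0 < k n.

Lemma weight_ratio : has_ubound (range (fun n => k n / k n.+1)) ->
  exists2 C, 0 < C & forall n, k n <= C * k n.+1.
Proof.
move=> [C kC].
have kC' n : k n <= C * k n.+1 by rewrite -ler_pdivrMr//; apply: kC; exists n.
exists C => //; have := lt_le_trans (k_gt0 0) (kC' 0%N).
by rewrite pmulr_lgt0.
Qed.

Lemma weight_tail :
  ereal_sup [set (\sum_(m <= j < n./2.+1) k j * k (n - j)%N / k n)%:E
    | n in [set n | (2 * m <= n)%N]] @[m --> \oo] --> (0 : \bar R) ->
  forall e, 0 < e -> exists m, forall n, (2 * m <= n)%N ->
  \sum_(m <= j < n./2.+1) k j * k (n - j)%N <= e * k n.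
Proof.
move=> kt e e0.
have e0' : nbhs (0 : \bar R) [set y | (y < e%:E)%E].
  exact: (@nbhs_open_ereal_lt _ 0 (fun=> e)).
have [m _ mk] := kt _ e0'.
exists m => n mn; rewrite -ler_pdivrMr// mulr_suml -lee_fin.
apply: le_trans (ltW (mk m (leqnn _))); apply: ereal_sup_ubound.
by exists n.
Qed.

(** For large n the n-th root of k_n is at least rho; the finitely many other n, among them n = 0,
    are absorbed in the constant. *)
Lemma weight_root : (k n `^ n%:R^-1) @[n --> \oo] --> (1 : R) ->
  forall rho : R, 0 < rho < 1 ->
  exists2 C, 0 < C & forall n, rho ^+ n <= C * k n.
Proof.
move=> kr rho /andP[r0 r1].
have [N _ Nk] : \forall n \near \oo, rho <= k n `^ n%:R^-1.
  by apply: (@cvgr_ge _ _ _ _ _ _ kr).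
have [C C0 kC] := finite_bound (fun n => rho ^+ n) N.+1 k_gt0.
exists (C + 1) => [|n]; first by rewrite ltr_wpDl.
rewrite mulrDl mul1r; have [nN|Nn] := ltnP n N.+1.
  rewrite (le_trans (ler_norm _))// (le_trans (kC n nN))// lerDl ltW//.
rewrite (@le_trans _ _ (k n))//; last by rewrite lerDr mulr_ge0// ltW.
rewrite -[leRHS]powRr1 ?(ltW (k_gt0 n))//.
rewrite -(@mulVf _ (n%:R : R)) ?pnatr_eq0; last lia.
rewrite powRrM powR_mulrn ?powR_ge0// lerXn2r ?nnegrE ?powR_ge0 ?(ltW r0)//.
by apply: Nk => /=; exact: ltnW.
Qed.

End WeightHypotheses.

(** * Bounded operators and adjoints *)

Section RealNorm.
Variable R : realType.

Lemma pos_complexE (e : R[i]) : 0 < e -> exists2 r : R, 0 < r & e = r%:C.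
Proof.
move=> e0; have er : e = (complex.Re e)%:C by rewrite RRe_real// gtr0_real.
by exists (complex.Re e) => //; rewrite -ltcR -er.
Qed.

Lemma rnormN (V : normedModType R[i]) (x : V) : rnorm (- x) = rnorm x.
Proof. by rewrite /rnorm normrN. Qed.

Lemma rnorm0 (V : normedModType R[i]) : rnorm (0 : V) = 0.
Proof. by rewrite /rnorm normr0. Qed.

Lemma rnorm_eq0 (V : normedModType R[i]) (x : V) : rnorm x = 0 -> x = 0.
Proof. by move=> x0; apply/normr0_eq0; rewrite -rnormE x0. Qed.

Lemma rnormB (V : normedModType R[i]) (x y : V) :
  rnorm (x - y) <= rnorm x + rnorm y.
Proof. by rewrite -(rnormN y) rnormD. Qed.

Lemma rnormZr (V : normedModType R[i]) (t : R) (x : V) :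
  rnorm (t%:C *: x) = `|t| * rnorm x.
Proof. by rewrite rnormZ normc_def/= expr0n addr0 sqrtr_sqr. Qed.

Lemma rdistC (V : normedModType R[i]) (x y : V) : rnorm (x - y) = rnorm (y - x).
Proof. by rewrite -rnormN opprB. Qed.

(** Radii of balls over R[i] are complex; this moves convergence to real sequences, where the
    order-theoretic limit results apply. *)
Lemma cvg_rnormP (V : normedModType R[i]) (u : nat -> V) (l : V) :
  u @ \oo --> l <-> (fun n => rnorm (u n - l)) @ \oo --> (0 : R).
Proof.
split=> [/cvgrPdist_lt ul|/cvgr0Pnorm_lt ul].
  apply/cvgr0Pnorm_lt => e e0; have e0' : 0 < e%:C by rewrite ltcR.
  move: (ul _ e0'); apply: filterS => n.
  by rewrite -rnormE ltcR rdistC ger0_norm ?rnorm_ge0.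
apply/cvgrPdist_lt => _ /pos_complexE[e e0 ->]; move: (ul _ e0).
by apply: filterS => n; rewrite -rnormE ltcR rdistC ger0_norm ?rnorm_ge0.
Qed.

Lemma rnorm_complete (V : completeNormedModType R[i]) (u : nat -> V) :
  (forall e : R, 0 < e -> exists N, forall n m, (N <= n)%N -> (n <= m)%N ->
    rnorm (u m - u n) <= e) ->
  exists l, (fun n => rnorm (u n - l)) @ \oo --> (0 : R).
Proof.
move=> cu; suff /cvg_ex[l /cvg_rnormP ul] : cvgn u by exists l.
apply/cauchy_cvgP/cauchy_exP => _/posnumP[e].
have [r r0 er] := pos_complexE (gt0 e).
have [N Nu] := cu _ (divr_gt0 r0 (ltr0Sn _ 1)).
exists (u N); exists N => // n /= Nn.
rewrite -ball_normE/= -rnormE rdistC er ltcR.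
by rewrite (le_lt_trans (Nu _ _ (leqnn N) Nn))// ltr_pdivrMr// ltr_pMr// ltr1n.
Qed.

Lemma continuous_rbounded (V W : normedModType R[i]) (A : 'L(V, W)) :
  exists2 C : R, 0 < C & forall x, rnorm (A x) <= C * rnorm x.
Proof.
have /linear_bounded_continuous/linear_boundedP[r [rR rA]] :=
  @bop_continuous _ _ _ A.
have r0 : r < `|r| + 1.
  by rewrite (le_lt_trans (real_ler_norm rR))// ltrDl.
exists (complex.Re (`|r| + 1)).
  rewrite -ltcR RRe_real ?ltr_wpDl// ger0_real// addr_ge0//.
move=> x; have := rA _ r0 x.
rewrite -!rnormE; have -> : `|r| + 1 = (complex.Re (`|r| + 1))%:C.
  by rewrite RRe_real// ger0_real// addr_ge0.
by rewrite -rmorphM lecR.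
Qed.

Lemma rbounded_continuous (V W : normedModType R[i]) (A : {linear V -> W})
    (C : R) :
  (forall x, rnorm (A x) <= C * rnorm x) -> continuous A.
Proof.
move=> AC; apply: bounded_linear_continuous; apply/linear_boundedP.
exists C%:C; split.
  by rewrite complex_real.
move=> r Cr x; rewrite -[leLHS]rnormE.
apply: le_trans (_ : C%:C * `|x| <= _); last by rewrite ler_wpM2r// ltW.
by rewrite -rnormE -rmorphM lecR.
Qed.

Lemma linear_fun_of (V W : normedModType R[i]) (f : V -> W) :
  (forall a x y, f (a *: x + y) = a *: f x + f y) ->
  exists g : {linear V -> W}, forall x, g x = f x.
Proof.
move=> fl; pose fL := GRing.isLinear.Build R[i] V W *:%R f fl.
pose g : {linear V -> W} := HB.pack f fL.
by exists g.
Qed.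

Lemma bop_of (V W : normedModType R[i]) (f : V -> W) (C : R) :
  (forall a x y, f (a *: x + y) = a *: f x + f y) ->
  (forall x, rnorm (f x) <= C * rnorm x) ->
  exists A : 'L(V, W), forall x, A x = f x.
Proof.
move=> /linear_fun_of[g gf] fC.
have gC x : rnorm (g x) <= C * rnorm x by rewrite gf.
by exists (BoundedOperator (rbounded_continuous gC)).
Qed.

Lemma cvg_rnorm_unique (V : normedModType R[i]) (u : nat -> V) (l l' : V) :
  (fun n => rnorm (u n - l)) @ \oo --> (0 : R) ->
  (fun n => rnorm (u n - l')) @ \oo --> (0 : R) -> l = l'.
Proof.
move=> /cvg_rnormP ul /cvg_rnormP ul'.
by apply: (cvg_unique _ ul ul'); exact: norm_hausdorff.
Qed.

Lemma cvg_rnorm_linear (V : normedModType R[i]) (u v : nat -> V) (l m : V)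
    (a : R[i]) :
  (fun n => rnorm (u n - l)) @ \oo --> (0 : R) ->
  (fun n => rnorm (v n - m)) @ \oo --> (0 : R) ->
  (fun n => rnorm (a *: u n + v n - (a *: l + m))) @ \oo --> (0 : R).
Proof.
move=> /cvg_rnormP ul /cvg_rnormP vm; apply/cvg_rnormP.
by apply: cvgD => //; apply: cvgZl_tmp.
Qed.

End RealNorm.

(** * Real inner products, Riesz representation and adjoints *)

Section InnerProduct.
Variables (R : realType) (H : hilbertType R).
Implicit Types (x y z : H) (a : R[i]) (t : R).

(** A real inner product with the same norm, which keeps estimates inside R; complex identities are
    recovered through [eq_of_Re_linear]. *)
Definition rdot x y : R := complex.Re '[x, y].

Lemma hdotDl x y z : '[x + y, z] = '[x, z] + '[y, z].
Proof. exact: linearDl. Qed.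

Lemma hdotDr x y z : '[x, y + z] = '[x, y] + '[x, z].
Proof. exact: linearDr. Qed.

Lemma hdotZl a x y : '[a *: x, y] = a * '[x, y].
Proof. exact: linearZl_LR. Qed.

Lemma hdotZr a x y : '[x, a *: y] = a^* * '[x, y].
Proof. exact: linearZr_LR. Qed.

Lemma hdotC x y : '[x, y] = ('[y, x])^*.
Proof. by rewrite hermC expr0 mul1r. Qed.

Lemma rdotC x y : rdot x y = rdot y x.
Proof. by rewrite /rdot hdotC; case: ('[y, x]). Qed.

Lemma rdotDl x y z : rdot (x + y) z = rdot x z + rdot y z.
Proof. by rewrite /rdot hdotDl raddfD. Qed.

Lemma Re_realM t (c : R[i]) : complex.Re (t%:C * c) = t * complex.Re c.
Proof. by case: c => c d; rewrite /= mul0r subr0. Qed.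

Lemma rdotZl t x y : rdot (t%:C *: x) y = t * rdot x y.
Proof. by rewrite /rdot hdotZl Re_realM. Qed.

Lemma rdotDr x y z : rdot x (y + z) = rdot x y + rdot x z.
Proof. by rewrite rdotC rdotDl !(rdotC x). Qed.

Lemma rdotZr t x y : rdot x (t%:C *: y) = t * rdot x y.
Proof. by rewrite rdotC rdotZl (rdotC x). Qed.

Lemma rdotNl x y : rdot (- x) y = - rdot x y.
Proof.
by rewrite -[- x]scaleN1r -(rmorphN1 (real_complex R)) rdotZl mulN1r.
Qed.

Lemma rdotNr x y : rdot x (- y) = - rdot x y.
Proof. by rewrite rdotC rdotNl rdotC. Qed.

Lemma rdotBl x y z : rdot (x - y) z = rdot x z - rdot y z.
Proof. by rewrite rdotDl rdotNl. Qed.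

Lemma rdotBr x y z : rdot x (y - z) = rdot x y - rdot x z.
Proof. by rewrite rdotDr rdotNr. Qed.

Lemma rdot0l y : rdot 0 y = 0.
Proof. by rewrite -(subrr y) rdotBl subrr. Qed.

Lemma rdot_suml I (r : seq I) (f : I -> H) y :
  rdot (\sum_(i <- r) f i) y = \sum_(i <- r) rdot (f i) y.
Proof.
by apply: (big_morph (rdot^~ y)) => [u v|]; [exact: rdotDl|exact: rdot0l].
Qed.

Lemma hdotxx x : '[x, x] = (rnorm x ^+ 2)%:C.
Proof. by rewrite -sqr_hnorm -rnormE rmorphXn. Qed.

Lemma rdotxx x : rdot x x = rnorm x ^+ 2.
Proof. by rewrite /rdot hdotxx. Qed.

Lemma rnorm_sqrD x y :
  rnorm (x + y) ^+ 2 = rnorm x ^+ 2 + 2 * rdot x y + rnorm y ^+ 2.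
Proof. by rewrite -!rdotxx rdotDl !rdotDr (rdotC y x); ring. Qed.

Lemma rnorm_sqrB x y :
  rnorm (x - y) ^+ 2 = rnorm x ^+ 2 - 2 * rdot x y + rnorm y ^+ 2.
Proof. by rewrite rnorm_sqrD rdotNr rnormN; ring. Qed.

(** Cauchy-Schwarz, by expanding the squared norm of |y| x - |x| y. *)
Lemma rdot_le x y : rdot x y <= rnorm x * rnorm y.
Proof.
have [x0|x0] := eqVneq (rnorm x) 0.
  by rewrite x0 mul0r (rnorm_eq0 x0) rdot0l.
have [y0|y0] := eqVneq (rnorm y) 0.
  by rewrite y0 mulr0 (rnorm_eq0 y0) rdotC rdot0l.
have px : 0 < rnorm x by rewrite lt_def x0 rnorm_ge0.
have py : 0 < rnorm y by rewrite lt_def y0 rnorm_ge0.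
have := sqr_ge0 (rnorm ((rnorm y)%:C *: x - (rnorm x)%:C *: y)).
rewrite rnorm_sqrB !rnormZr rdotZl rdotZr !ger0_norm ?rnorm_ge0// => h.
have : 0 <= 2 * (rnorm x * rnorm y) * (rnorm x * rnorm y - rdot x y) by lra.
by rewrite pmulr_rge0 ?mulr_gt0// subr_ge0.
Qed.

Lemma normr_rdot_le x y : `|rdot x y| <= rnorm x * rnorm y.
Proof. by rewrite ler_norml rdot_le lerNl -rdotNl -(rnormN x) rdot_le. Qed.

Lemma parallelogram x y :
  rnorm (x - y) ^+ 2 =
  2 * rnorm x ^+ 2 + 2 * rnorm y ^+ 2 - rnorm (x + y) ^+ 2.
Proof. by rewrite rnorm_sqrB rnorm_sqrD; ring. Qed.

Lemma cvg_rdot (u : nat -> H) (l z : H) :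
  (fun n => rnorm (u n - l)) @ \oo --> (0 : R) ->
  (fun n => rdot (u n) z) @ \oo --> rdot l z.
Proof.
move=> ul; apply/subr_cvg0; apply/cvgr0Pnorm_le => e e0.
have e1 : 0 < e / (rnorm z + 1) by rewrite divr_gt0// ltr_wpDl// rnorm_ge0.
move/cvgr0Pnorm_le : ul => /(_ _ e1); apply: filterS => n.
rewrite ger0_norm ?rnorm_ge0// => un; rewrite /= -rdotBl.
rewrite (le_trans (normr_rdot_le _ _))//.
rewrite (le_trans (ler_wpM2r (rnorm_ge0 _) un))//.
rewrite mulrAC ler_pdivrMr ?ltr_wpDl ?rnorm_ge0// ler_wpM2l ?(ltW e0)//.
by rewrite lerDl.
Qed.

Lemma eq_of_rdot x y : (forall z, rdot z x = rdot z y) -> x = y.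
Proof.
move=> xy; apply/eqP; rewrite -subr_eq0; apply/eqP/rnorm_eq0/eqP.
by rewrite -sqrf_eq0 -rdotxx rdotBr xy subrr.
Qed.

(** Homogeneity gives Im f(x) = Re f(-i x), so the real part determines f. *)
Lemma eq_of_Re_linear (f g : H -> R[i]) :
  (forall a x, f (a *: x) = a * f x) -> (forall a x, g (a *: x) = a * g x) ->
  (forall x, complex.Re (f x) = complex.Re (g x)) -> f = g.
Proof.
move=> fZ gZ fg; apply/funext => x.
have := fg (Complex 0 (- 1) *: x); have := fg x.
rewrite fZ gZ; case: (f x) => a b; case: (g x) => c d /= -> .
by rewrite !mul0r !sub0r !mulN1r !opprK => ->.
Qed.

Lemma rdot_eq (S T : H -> H) : (forall x y, rdot (S x) y = rdot x (T y)) ->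
  (forall a x, S (a *: x) = a *: S x) ->
  forall x y, '[S x, y] = '[x, T y].
Proof.
move=> ST SZ x y.
have := @eq_of_Re_linear (fun x => '[S x, y]) (fun x => '[x, T y]).
move=> /(_ _ _ _)/(congr1 (fun f => f x)) -> //.
- by move=> a z; rewrite SZ hdotZl.
- by move=> a z; rewrite hdotZl.
- by move=> z; exact: ST.
Qed.

(* The representing vector minimises [|x|^2 - 2 Re f(x)]; minimising sequences
   are Cauchy by the parallelogram law. *)
Lemma riesz (f : H -> R[i]) (C : R) :
  (forall x y, f (x + y) = f x + f y) -> (forall a x, f (a *: x) = a * f x) ->
  (forall x, `|complex.Re (f x)| <= C * rnorm x) ->
  exists y, forall x, f x = '[x, y].
Proof.
move=> fD fZ fC; pose g x := complex.Re (f x).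
have gD x y : g (x + y) = g x + g y by rewrite /g fD raddfD.
have gZ t x : g (t%:C *: x) = t * g x by rewrite /g fZ Re_realM.
pose phi x := rnorm x ^+ 2 - 2 * g x.
pose S := range phi.
have lbS : has_lbound S.
  (* Complete the square: |x|^2 - 2 C |x| >= - C^2. *)
  exists (- C ^+ 2) => _ [x _ <-]; rewrite /phi.
  have := fC x; rewrite -/(g x) => /(le_trans (ler_norm _)) gC.
  have := sqr_ge0 (rnorm x - C); rewrite sqrrB; lra.
have infS : has_inf S by split => //; exists (phi 0); exists 0.
pose m := inf S.
have mphi x : m <= phi x by apply: ge_inf => //; exists x.
have : forall n : nat, exists x, phi x < m + n.+1%:R^-1.
  move=> n; have n0 : 0 < (n.+1%:R : R)^-1 by rewrite invr_gt0.
  have [_ [x _ <-] xm] := inf_adherent n0 infS.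
  by exists x.
move=> /choice[u um].
have inv0 : (fun n => (n.+1%:R : R)^-1) @ \oo --> (0 : R).
  exact: cvg_harmonic.
have cauchy_u e : 0 < e -> exists N, forall n k, (N <= n)%N -> (n <= k)%N ->
    rnorm (u k - u n) <= e.
  move=> e0; have e4 : 0 < e ^+ 2 / 4 by rewrite divr_gt0// exprn_gt0.
  have [N _ NE] := (cvgr0Pnorm_le _).1 inv0 _ e4.
  exists N => n k Nn nk.
  have bnd j : (N <= j)%N -> phi (u j) <= m + e ^+ 2 / 4.
    move=> Nj; rewrite (le_trans (ltW (um j)))// lerD2l.
    by rewrite (le_trans (ler_norm _))// NE.
  have h1 := bnd _ Nn; have h2 := bnd _ (leq_trans Nn nk).
  (* By the parallelogram law, |u_k - u_n|^2 is 2 phi(u_k) + 2 phi(u_n) - 4 phi at the midpoint,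
     hence at most 4 (e^2 / 4). *)
  have h3 := mphi ((2^-1 : R)%:C *: (u k + u n)).
  rewrite -ler_sqr ?nnegrE ?rnorm_ge0 ?(ltW e0)// parallelogram.
  move: h1 h2 h3; rewrite /phi rnormZr gZ gD exprMn real_normK ?num_real//.
  rewrite exprVn.
  lra.
have [y uy] := rnorm_complete cauchy_u.
have key z : g z = rdot z y.
  (* Minimality tested at u_n + t z, in the limit; a quadratic in t without constant term that stays
     nonnegative has no linear term. *)
  have ineq t : 0 <= t ^+ 2 * rnorm z ^+ 2 + 2 * t * (rdot y z - g z).
    have hn n : - (n.+1%:R : R)^-1 <=
        t ^+ 2 * rnorm z ^+ 2 + 2 * t * (rdot (u n) z - g z).
      have := mphi (u n + t%:C *: z); have := um n.
      rewrite /phi rnorm_sqrD gD gZ rnormZr rdotZr exprMn.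
      rewrite real_normK ?num_real//.
      by move: (n.+1%:R^-1) => v; rewrite -mulrA mulrBr; lra.
    have c1 : (fun n => - (n.+1%:R : R)^-1) @ \oo --> (- 0 : R) by exact: cvgN.
    have c2 :
        (fun n => t ^+ 2 * rnorm z ^+ 2 + 2 * t * (rdot (u n) z - g z)) @ \oo -->
        t ^+ 2 * rnorm z ^+ 2 + 2 * t * (rdot y z - g z).
      apply: cvgD; first exact: cvg_cst.
      by apply: cvgMl_tmp; apply: cvgB; [exact: cvg_rdot|exact: cvg_cst].
    by rewrite -oppr0; apply: (ler_cvg_to c1 c2); exact: nearW.
  rewrite rdotC; set d := rdot y z - g z in ineq.
  suff : d = 0 by rewrite /d; lra.
  have q0 : 0 < rnorm z ^+ 2 + 1 by rewrite ltr_wpDl// sqr_ge0.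
  (* The 1 in the denominator covers z = 0. *)
  have := ineq (- d / (rnorm z ^+ 2 + 1)); set q := rnorm z ^+ 2 in q0 *.
  rewrite expr_div_n sqrrN => h.
  have : 0 <= (d ^+ 2 / (q + 1) ^+ 2 * q + 2 * (- d / (q + 1)) * d) *
      (q + 1) ^+ 2.
    by rewrite mulr_ge0// sqr_ge0.
  rewrite (_ : _ * _ ^+ 2 = - (d ^+ 2 * (q + 2))); last first.
    by field; rewrite gt_eqF.
  rewrite oppr_ge0 => h2; apply/eqP; rewrite -sqrf_eq0 eq_le sqr_ge0 andbT.
  by move: h2; rewrite pmulr_lle0//; lra.
exists y => x; have := @eq_of_Re_linear f (fun x => '[x, y]).
move=> /(_ _ _ _)/(congr1 (fun f => f x)) -> //.
by move=> a z; rewrite hdotZl.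
Qed.

(** Riesz provides the values S z, and |S u|^2 = Re <T S u, u> <= C |S u| |u| bounds S. Hence the
    choice defining [adjoint] never falls back to its default. *)
Lemma adjointP (T : 'L(H)) x y : '[T x, y] = '[x, adjoint T y].
Proof.
have [C C0 TC] := continuous_rbounded T.
have adj z : exists w, forall x, '[T x, z] = '[x, w].
  apply: (@riesz (fun x => '[T x, z]) (C * rnorm z)).
  - by move=> u v; rewrite linearD hdotDl.
  - by move=> a u; rewrite linearZ hdotZl.
  - move=> u; rewrite (le_trans (normr_rdot_le _ _))// mulrAC.
    by rewrite ler_wpM2r ?rnorm_ge0.
have [S TS] := choice adj.
have SL a u v : S (a *: u + v) = a *: S u + S v.
  apply: eq_of_rdot => z; rewrite /rdot hdotDr hdotZr -!TS.
  by rewrite hdotDr hdotZr.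
have SC u : rnorm (S u) <= C * rnorm u.
  have [->|Su0] := eqVneq (rnorm (S u)) 0.
    by rewrite mulr_ge0 ?rnorm_ge0// ltW.
  have Su : 0 < rnorm (S u) by rewrite lt_def Su0 rnorm_ge0.
  rewrite -(ler_pM2l Su) -expr2 -rdotxx {1}/rdot -TS.
  rewrite (le_trans (rdot_le _ _))// mulrA (mulrC (rnorm (S u))).
  by rewrite ler_wpM2r ?rnorm_ge0.
have [A AS] := bop_of SL SC.
suff : [set S : 'L(H) | forall x y, '[T x, y] = '[x, S y]] (adjoint T) by [].
by apply: (@xgetPex _ (bop0 H H)); exists A => u v; rewrite AS -TS.
Qed.

Lemma rdot_adjoint (T : 'L(H)) x y : rdot (T x) y = rdot x (adjoint T y).
Proof. by rewrite /rdot adjointP. Qed.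

Lemma rdot_iter_adjoint (T : 'L(H)) n x y :
  rdot (iter n T x) y = rdot x (iter n (adjoint T) y).
Proof.
elim: n x y => [//|n ih] x y.
by rewrite iterSr ih rdot_adjoint -iterS.
Qed.

(* Im <A z, z> = 0 at z = x, y and x + i y. *)
Lemma nonneg_symmetric (A : 'L(H)) : nonneg_operator A ->
  forall x y, rdot (A x) y = rdot x (A y).
Proof.
move=> A0 x y.
have im z : complex.Im '[A z, z] = 0.
  by have := A0 z; rewrite lecE => /andP[/eqP].
have := im (x + Complex 0 1 *: y).
have -> : A (x + Complex 0 1 *: y) = A x + Complex 0 1 *: A y.
  by rewrite linearD linearZ.
rewrite !hdotDl !hdotDr !hdotZl !hdotZr.
have := im x; have := im y.
rewrite (rdotC x) /rdot.
case: ('[A x, x]) => a b; case: ('[A y, y]) => c d.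
case: ('[A x, y]) => e f; case: ('[A y, x]) => g h /=.
move=> -> ->; lra.
Qed.

(** Symmetry makes <A x, x> equal to its own conjugate, so its imaginary part vanishes. *)
Lemma nonneg_of_rdot (A : 'L(H)) :
  (forall x y, rdot (A x) y = rdot x (A y)) -> (forall x, 0 <= rdot (A x) x) ->
  nonneg_operator A.
Proof.
move=> As A0 x; have Axx : '[A x, x] = '[x, A x].
  by apply: rdot_eq => // a z; rewrite linearZ.
have := A0 x; rewrite lecE /rdot => ->; rewrite andbT.
move: Axx; rewrite (hdotC x); case: ('[A x, x]) => a b /= [] h.
by apply/eqP; lra.
Qed.

(* Expand <Q z, z> >= 0 at z = x - Q x / C. *)
Lemma rnorm_sqr_le_of_pos (Q : H -> H) (C : R) : 0 < C ->
  (forall t x y, Q (x - t%:C *: y) = Q x - t%:C *: Q y) ->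
  (forall x y, rdot (Q x) y = rdot x (Q y)) ->
  (forall x, 0 <= rdot (Q x) x <= C * rnorm x ^+ 2) ->
  forall x, rnorm (Q x) ^+ 2 <= C * rdot (Q x) x.
Proof.
move=> C0 QB Qs Qb x; have /andP[+ _] := Qb (x - C^-1%:C *: Q x).
rewrite QB rdotBl !rdotBr !rdotZl !rdotZr (Qs (Q x) x) !rdotxx.
have /andP[_ h] := Qb (Q x) => h2.
have : C^-1 * C^-1 * rdot (Q (Q x)) (Q x) <=
    C^-1 * C^-1 * (C * rnorm (Q x) ^+ 2).
  by rewrite ler_wpM2l// mulr_ge0// invr_ge0 ltW.
rewrite (_ : _ * (C * _) = C^-1 * rnorm (Q x) ^+ 2); last first.
  by field; rewrite gt_eqF.
move=> h3; rewrite -ler_pdivrMl//; lra.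
Qed.

End InnerProduct.

(** * Hereditary series and square roots *)

Section Hereditary.
Variables (R : realType) (H : hilbertType R).
Implicit Types (x y z : H) (c : R^nat) (S T : 'L(H)).

Lemma rnorm_lim_le (V : normedModType R[i]) (u : nat -> V) (l : V) (M : R) :
  (fun n => rnorm (u n - l)) @ \oo --> (0 : R) ->
  (forall n, rnorm (u n) <= M) -> rnorm l <= M.
Proof.
move=> ul uM; rewrite -subr_le0; apply: (ler_cvg_to (cvg_cst _) ul).
apply: nearW => n; rewrite lerBlDl rdistC.
rewrite -[X in rnorm X](subrK (u n)) addrC (le_trans (rnormD _ _))//.
by rewrite lerD2r.
Qed.

Definition hereditary_series c T x N : H :=
  series (fun n => (c n)%:C *: iter n (adjoint T) (iter n T x)) N.

Lemma rdot_hereditary_series c T x y N :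
  rdot (hereditary_series c T x N) y =
  \sum_(n < N) c n * rdot (iter n T x) (iter n T y).
Proof.
rewrite /hereditary_series /series/= rdot_suml big_mkord.
apply: eq_bigr => n _; rewrite rdotZl; congr (_ * _).
by rewrite rdotC -rdot_iter_adjoint rdotC.
Qed.

Lemma hereditary_sum_rdot c T S x y : hereditary_sum c T S ->
  (fun N => \sum_(n < N) c n * rdot (iter n T x) (iter n T y)) @ \oo -->
    rdot (S x) y.
Proof.
move=> /(_ x)/cvg_rnormP/cvg_rdot => /(_ y).
by under eq_fun do rewrite -/(hereditary_series c T x _) rdot_hereditary_series.
Qed.

Lemma hereditary_sum_rnorm c T S x : hereditary_sum c T S ->
  (fun N => \sum_(n < N) c n * rnorm (iter n T x) ^+ 2) @ \oo --> rdot (S x) x.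
Proof.
move=> /(@hereditary_sum_rdot _ _ _ x x).
by under eq_fun do under eq_bigr do rewrite rdotxx.
Qed.

Lemma hereditary_sum_symmetric c T S x y : hereditary_sum c T S ->
  rdot (S x) y = rdot x (S y).
Proof.
move=> cS; rewrite (rdotC x).
apply: (cvg_unique _ (@hereditary_sum_rdot _ _ _ x y cS)) => //.
have := @hereditary_sum_rdot _ _ _ y x cS.
by under eq_fun do under eq_bigr do rewrite rdotC.
Qed.

Lemma hereditaryP c T :
  hereditary_cvg c T -> hereditary_sum c T (hereditary c T).
Proof. exact: (@xgetPex _ (bop0 H H) [set S | hereditary_sum c T S]). Qed.

(** The quadratic forms of the partial sums increase to that of the bounded sum. This is the
    converse of [hereditary_cvg_bounded]. *)
Lemma hereditary_bound c T : (forall n, 0 <= c n) -> hereditary_cvg c T ->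
  exists2 C : R, 0 < C & forall N x,
    \sum_(n < N) c n * rnorm (iter n T x) ^+ 2 <= C * rnorm x ^+ 2.
Proof.
move=> c0 [S cS]; have [C C0 SC] := continuous_rbounded S.
exists C => // N x; have cN := @hereditary_sum_rnorm _ _ _ x cS.
apply: (@le_trans _ _ (rdot (S x) x)).
  rewrite -(cvg_lim _ cN)//; apply: (nondecreasing_cvgn_le _ (cvgP _ cN)).
  apply: (@nondecreasing_sum_ord _ (fun j => c j * rnorm (iter j T x) ^+ 2)).
  by move=> j; rewrite mulr_ge0// sqr_ge0.
by rewrite (le_trans (rdot_le _ _))// expr2 mulrA ler_wpM2r// rnorm_ge0.
Qed.

Lemma hereditary_series_linear c T N a x y :
  hereditary_series c T (a *: x + y) N =
  a *: hereditary_series c T x N + hereditary_series c T y N.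
Proof.
have itl (A : 'L(H)) n u v :
    iter n A (a *: u + v) = a *: iter n A u + iter n A v.
  by elim: n => //= n ->; rewrite linearP.
rewrite /hereditary_series /series/= scaler_sumr -big_split/=.
by apply: eq_bigr => n _; rewrite !itl scalerDr !scalerA mulrC.
Qed.

(* The increments Q of the partial sums satisfy 0 <= Q <= C, hence
   |Qx|^2 <= C <Qx, x>. *)
Lemma hereditary_cvg_bounded c T (C : R) : 0 < C -> (forall n, 0 <= c n) ->
  (forall N x, \sum_(n < N) c n * rnorm (iter n T x) ^+ 2 <= C * rnorm x ^+ 2) ->
  hereditary_cvg c T.
Proof.
move=> C0 c0 cC; pose P := hereditary_series c T.
pose q x N := \sum_(n < N) c n * rnorm (iter n T x) ^+ 2.
have Pq x N : rdot (P x N) x = q x N.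
  by rewrite rdot_hereditary_series; apply: eq_bigr => n _; rewrite rdotxx.
have q_nd x m n : (m <= n)%N -> q x m <= q x n.
  apply: (@nondecreasing_sum_ord _ (fun j => c j * rnorm (iter j T x) ^+ 2)).
  by move=> j; rewrite mulr_ge0// sqr_ge0.
have Plin (t : R[i]) u v N : P (u - t *: v) N = P u N - t *: P v N.
  by rewrite addrC -scaleNr /P hereditary_series_linear scaleNr addrC.
have incr m n x : (m <= n)%N ->
    rnorm (P x n - P x m) ^+ 2 <= C * (q x n - q x m).
  move=> mn; rewrite -!Pq -rdotBl.
  apply: (@rnorm_sqr_le_of_pos _ _ (fun x => P x n - P x m)) => //.
  - by move=> t u v; rewrite !Plin scalerBr !opprD !opprK addrACA.
  - move=> u v; rewrite rdotBl rdotBr (rdotC u) (rdotC u).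
    rewrite !rdot_hereditary_series.
    by congr (_ - _); apply: eq_bigr => i _; rewrite (rdotC (iter i T u)).
  - move=> u; rewrite rdotBl !Pq subr_ge0 q_nd//=.
    rewrite (le_trans _ (cC n u))// lerBlDr lerDl.
    by apply: sumr_ge0 => i _; rewrite mulr_ge0// sqr_ge0.
have cauchyP x e : 0 < e -> exists N, forall n m, (N <= n)%N -> (n <= m)%N ->
    rnorm (P x m - P x n) <= e.
  move=> e0; have cq : cvgn (q x).
    apply: nondecreasing_is_cvgn; first exact: q_nd.
    by exists (C * rnorm x ^+ 2) => _ [n _ <-]; exact: cC.
  have e1 : 0 < e ^+ 2 / C by rewrite divr_gt0// exprn_gt0.
  have /cvgrPdist_le/(_ _ e1)[N _ qN] := cq.
  exists N => n m Nn nm; rewrite -ler_sqr ?nnegrE ?rnorm_ge0 ?(ltW e0)//.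
  rewrite (le_trans (incr _ _ _ nm))// mulrC -ler_pdivlMr//.
  apply: le_trans (qN n Nn); rewrite (le_trans _ (ler_norm _))// lerB//.
  by apply: nondecreasing_cvgn_le => //; exact: q_nd.
have /choice[S PS] x := rnorm_complete (cauchyP x).
have SL a x y : S (a *: x + y) = a *: S x + S y.
  apply: (cvg_rnorm_unique (PS _)).
  under eq_fun do rewrite /P hereditary_series_linear.
  exact: cvg_rnorm_linear.
have SC x : rnorm (S x) <= C * rnorm x.
  apply: (rnorm_lim_le (PS x)) => n.
  have Cx : 0 <= C * rnorm x by rewrite mulr_ge0 ?rnorm_ge0// ltW.
  rewrite -ler_sqr ?nnegrE ?rnorm_ge0//.
  (* The empty partial sum is 0, so this bounds |P x n|^2 by C^2 |x|^2. *)
  have := incr 0%N n x (leq0n _).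
  rewrite /q big_ord0 subr0 {2}/P /hereditary_series /series/= big_geq// subr0.
  move=> /le_trans; apply; rewrite exprMn (expr2 C) -mulrA.
  by rewrite ler_wpM2l ?(ltW C0)//; exact: cC.
have [A AS] := bop_of SL SC.
exists A => x; apply/cvg_rnormP; rewrite AS; exact: PS.
Qed.

(** Write c = |c| - (|c| - c): the second sequence lies between 0 and 2 |c|, so its series converges
    by boundedness. *)
Lemma hereditary_cvg_normr c T :
  hereditary_cvg (fun n => `|c n|) T -> hereditary_cvg c T.
Proof.
move=> /[dup] [[S1 cS1]] cT.
have [C C0 cC] := hereditary_bound (fun n => normr_ge0 (c n)) cT.
have [S2 cS2] : hereditary_cvg (fun n => `|c n| - c n) T.
  apply: (@hereditary_cvg_bounded _ _ (2 * C)) => [|n|N x].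
  - by rewrite mulr_gt0.
  - by rewrite subr_ge0 ler_norm.
  - rewrite -mulrA (le_trans _ (ler_wpM2l _ (cC N x)))// mulr_sumr.
    apply: ler_sum => i _; rewrite [leRHS]mulrA ler_wpM2r ?sqr_ge0//.
    by have := ler_norm (- c i); rewrite normrN; lra.
have [C1 C10 SC1] := continuous_rbounded S1.
have [C2 C20 SC2] := continuous_rbounded S2.
have fL a x y : -1 *: S2 (a *: x + y) + S1 (a *: x + y) =
    a *: (-1 *: S2 x + S1 x) + (-1 *: S2 y + S1 y).
  have SP (S : 'L(H)) : S (a *: x + y) = a *: S x + S y by exact: linearP.
  by rewrite !SP !scalerDr !scalerA (mulrC a) addrACA.
have fC x : rnorm (-1 *: S2 x + S1 x) <= (C2 + C1) * rnorm x.
  by rewrite scaleN1r mulrDl (le_trans (rnormD _ _))// rnormN lerD.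
have [A AS] := bop_of fL fC.
exists A => x; apply/cvg_rnormP; rewrite AS.
have /cvg_rnormP h1 := cS1 x; have /cvg_rnormP h2 := cS2 x.
suff -> : series (fun n => (c n)%:C *: iter n (adjoint T) (iter n T x)) =
    (fun N => -1 *: series (fun n =>
      (`|c n| - c n)%:C *: iter n (adjoint T) (iter n T x)) N +
    series (fun n => (`|c n|)%:C *: iter n (adjoint T) (iter n T x)) N).
  exact: cvg_rnorm_linear.
apply/funext => N; rewrite /series/= scaler_sumr -big_split/=.
apply: eq_bigr => n _.
by rewrite scalerA -scalerDl rmorphB/= mulN1r opprB subrK.
Qed.

End Hereditary.

(** * Square roots of nonnegative operators *)

Section SquareRoot.
Variables (R : realType) (H : hilbertType R).
Implicit Types (x y z : H).

Let s_ (n : nat) : R := iter n (fun s : R => (1 + s ^+ 2) / 2) 0.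

Let s_S n : s_ n.+1 = (1 + s_ n ^+ 2) / 2. Proof. by []. Qed.

Let s_itv n : 0 <= s_ n <= 1.
Proof.
elim: n => [|n /andP[s0 s1]]; first by rewrite lexx ler01.
have s20 := sqr_ge0 (s_ n); have s21 : s_ n ^+ 2 <= 1 by rewrite expr_le1.
by rewrite s_S; apply/andP; split; lra.
Qed.

Let s_nd : nondecreasing_seq s_.
Proof.
apply/nondecreasing_seqP => n; rewrite s_S -subr_ge0.
rewrite (_ : _ - _ = (1 - s_ n) ^+ 2 / 2); last by field.
by rewrite divr_ge0// sqr_ge0.
Qed.

(* The iteration y <- (B + y^2) / 2 converges in norm to the solution of
   2 y = B + y^2, i.e. (1 - y)^2 = 1 - B, being dominated by its scalar version
   with B = 1. *)
Lemma contraction_half_square (B : H -> H) :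
  (forall a x y, B (a *: x + y) = a *: B x + B y) ->
  (forall x, rnorm (B x) <= rnorm x) ->
  (forall x y, rdot (B x) y = rdot x (B y)) ->
  exists Y : H -> H,
    [/\ forall a x y, Y (a *: x + y) = a *: Y x + Y y,
        forall x, rnorm (Y x) <= rnorm x,
        forall x y, rdot (Y x) y = rdot x (Y y) &
        forall x, B x + Y (Y x) = 2 *: Y x].
Proof.
move=> BL B1 Bs; pose h : R[i] := (2^-1 : R)%:C.
pose y_ n : H -> H := iter n (fun f x => h *: (B x + f (f x))) (fun=> 0).
have y_S n x : y_ n.+1 x = h *: (B x + y_ n (y_ n x)) by [].
have yL n a u v : y_ n (a *: u + v) = a *: y_ n u + y_ n v.
  elim: n u v => [|n ih] u v; first by rewrite /y_/= scaler0 addr0.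
  by rewrite !y_S BL !ih addrACA -(scalerDr a) (scalerDr h) !scalerA (mulrC h).
have yD n u v : y_ n (u + v) = y_ n u + y_ n v.
  by have := yL n 1 u v; rewrite !scale1r.
have y0 n : y_ n 0 = 0.
  by apply: (addrI (y_ n 0)); rewrite -yD !addr0.
have yN n u : y_ n (- u) = - y_ n u.
  by have := yL n (-1) u 0; rewrite !scaleN1r y0 !addr0.
have yB n u v : y_ n (u - v) = y_ n u - y_ n v by rewrite yD yN.
(* The iterates are polynomials in B, so they commute with every linear map commuting with B, in
   particular with each other. *)
have ycomm (f : H -> H) n x : (forall a u v, f (a *: u + v) = a *: f u + f v) ->
    (forall x, f (B x) = B (f x)) -> f (y_ n x) = y_ n (f x).
  move=> fL fB; have f0 : f 0 = 0.
    by have := fL (-1) 0 0; rewrite scaleN1r oppr0 addr0 scaleN1r addNr.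
  elim: n x => [x|n ih x]; first exact: f0.
  rewrite !y_S -[_ *: _]addr0 fL f0 addr0; congr (_ *: _).
  by rewrite -[B x]scale1r fL !scale1r fB !ih.
have yy_comm m n x : y_ m (y_ n x) = y_ n (y_ m x).
  by apply: (ycomm (y_ m)) => [|z]; [exact: yL|rewrite (ycomm B)].
have ybnd n x : rnorm (y_ n x) <= s_ n * rnorm x.
  elim: n x => [|n ih] x; first by rewrite rnorm0 mul0r.
  rewrite y_S rnormZr ger0_norm ?invr_ge0// s_S mulrAC mulrC.
  rewrite ler_wpM2r ?invr_ge0//.
  rewrite mulrDl mul1r (le_trans (rnormD _ _))// lerD// (le_trans (ih _))//.
  by rewrite expr2 -mulrA ler_wpM2l//; case/andP: (s_itv n).
have ysym n u v : rdot (y_ n u) v = rdot u (y_ n v).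
  elim: n u v => [|n ih] u v.
    by rewrite -[y_ 0%N u]/(0 : H) -[y_ 0%N v]/(0 : H) (rdotC u) !rdot0l.
  by rewrite !y_S rdotZl rdotZr rdotDl rdotDr Bs !ih.
have ystep n x : rnorm (y_ n.+1 x - y_ n x) <= (s_ n.+1 - s_ n) * rnorm x.
  elim: n x => [|n ih] x.
    by rewrite [y_ 0%N x]/= subr0 [s_ 0%N]/= subr0 ybnd.
  rewrite (y_S n.+1) (y_S n) -scalerBr rnormZr ger0_norm ?invr_ge0//.
  rewrite opprD addrACA subrr add0r.
  (* The factorisation p^2 - q^2 = (p + q)(p - q) for commuting p and q; the scalar increments
     satisfy the same identity. *)
  have -> : y_ n.+1 (y_ n.+1 x) - y_ n (y_ n x) =
      y_ n.+1 (y_ n.+1 x - y_ n x) + y_ n (y_ n.+1 x - y_ n x).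
    by rewrite !yB (yy_comm n) addrA subrK.
  have /andP[s0 _] := s_itv n; have /andP[s1 _] := s_itv n.+1.
  have := rnormD (y_ n.+1 (y_ n.+1 x - y_ n x)) (y_ n (y_ n.+1 x - y_ n x)).
  have := le_trans (ybnd n.+1 _) (ler_wpM2l s1 (ih x)).
  have := le_trans (ybnd n _) (ler_wpM2l s0 (ih x)).
  have -> : s_ n.+2 - s_ n.+1 = 2^-1 * ((s_ n.+1 - s_ n) * (s_ n.+1 + s_ n)).
    have := s_S n.+1; have := s_S n.
    by move: (s_ n.+2) (s_ n.+1) (s_ n) => a b c; lra.
  move: (rnorm _) (rnorm _) (rnorm _) (s_ n.+1) (s_ n) (rnorm x) => a b c d e f.
  lra.
have ydist m n x : (m <= n)%N ->
    rnorm (y_ n x - y_ m x) <= (s_ n - s_ m) * rnorm x.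
  elim: n => [|n ih].
    by rewrite leqn0 => /eqP->; rewrite !subrr rnorm0 mul0r.
  rewrite leq_eqVlt => /predU1P[->|]; first by rewrite !subrr rnorm0 mul0r.
  rewrite ltnS => /ih h1; have := ystep n x.
  have -> : y_ n.+1 x - y_ m x = (y_ n.+1 x - y_ n x) + (y_ n x - y_ m x).
    by rewrite addrA subrK.
  have := rnormD (y_ n.+1 x - y_ n x) (y_ n x - y_ m x); lra.
have cs : cvgn s_.
  apply: nondecreasing_is_cvgn => //; exists 1 => _ [n _ <-].
  by have /andP[] := s_itv n.
have ycauchy x e : 0 < e -> exists N, forall n m, (N <= n)%N -> (n <= m)%N ->
    rnorm (y_ m x - y_ n x) <= e.
  move=> e0; have x0 : 0 < rnorm x + 1 by rewrite ltr_wpDl ?rnorm_ge0.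
  have e1 : 0 < e / (rnorm x + 1) by rewrite divr_gt0.
  have /cvgrPdist_le/(_ _ e1)[N _ sN] := cs.
  exists N => n m Nn nm; rewrite (le_trans (ydist _ _ _ nm))//.
  rewrite (@le_trans _ _ ((s_ m - s_ n) * (rnorm x + 1)))//.
    by rewrite ler_wpM2l ?lerDl// subr_ge0 s_nd.
  rewrite -ler_pdivlMr//; apply: le_trans (sN n Nn).
  rewrite (le_trans _ (ler_norm _))// lerB//.
  exact: nondecreasing_cvgn_le.
have /choice[Y yY] x := rnorm_complete (ycauchy x).
have YL a u v : Y (a *: u + v) = a *: Y u + Y v.
  apply: (cvg_rnorm_unique (yY _)).
  under eq_fun do rewrite yL.
  exact: cvg_rnorm_linear.
have Y1 x : rnorm (Y x) <= rnorm x.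
  apply: (rnorm_lim_le (yY x)) => n; rewrite (le_trans (ybnd _ _))//.
  by rewrite ler_piMl ?rnorm_ge0//; case/andP: (s_itv n).
exists Y; split=> // [u v|x].
  rewrite (rdotC u); apply: (cvg_unique _ (cvg_rdot (yY u))) => //.
  have := cvg_rdot (z := u) (yY v).
  by under eq_fun do rewrite rdotC -ysym.
have yyY : (fun n => rnorm (y_ n (y_ n x) - Y (Y x))) @ \oo --> (0 : R).
  have c2 : (fun n => rnorm (y_ n x - Y x) + rnorm (y_ n (Y x) - Y (Y x))) @ \oo
      --> (0 + 0 : R).
    exact: cvgD.
  rewrite addr0 in c2; apply: (squeeze_cvgr _ (cvg_cst 0) c2).
  apply: nearW => n; rewrite rnorm_ge0/=.
  have -> : y_ n (y_ n x) - Y (Y x) =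
      y_ n (y_ n x - Y x) + (y_ n (Y x) - Y (Y x)) by rewrite yB addrA subrK.
  rewrite (le_trans (rnormD _ _))// lerD2r (le_trans (ybnd _ _))//.
  by rewrite ler_piMl ?rnorm_ge0//; case/andP: (s_itv n).
have YE : Y x = h *: (B x + Y (Y x)).
  apply: (@cvg_rnorm_unique _ _ (fun n => y_ n.+1 x)).
    by have := yY x; rewrite -cvg_shiftS.
  have cB : (fun=> rnorm (h *: B x - h *: B x)) @ \oo --> (0 : R).
    by rewrite subrr rnorm0; exact: cvg_cst.
  rewrite (_ : (fun n => _) = fun n => rnorm (h *: y_ n (y_ n x) + h *: B x -
      (h *: Y (Y x) + h *: B x))); first exact: cvg_rnorm_linear.
  by apply/funext => n; rewrite y_S !scalerDr !(addrC (h *: B x)).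
rewrite [in RHS]YE scalerA /h (_ : 2 * _ = 1) ?scale1r//.
by rewrite -(rmorph_nat (real_complex R)) -rmorphM divff// pnatr_eq0.
Qed.

(** For B = I - A/C, a contraction, the previous lemma gives Y with (I - Y)^2 = I - B = A/C. Then
    sqrt(C) (I - Y) is a square root, nonnegative because |Y x| <= |x|. *)
Lemma operator_sqrtP (A : 'L(H)) : nonneg_operator A ->
  nonneg_operator (operator_sqrt A) /\
  forall x, operator_sqrt A (operator_sqrt A x) = A x.
Proof.
move=> A0; have [C C0 AC] := continuous_rbounded A.
have As := nonneg_symmetric A0.
have Apos x : 0 <= rdot (A x) x by have := A0 x; rewrite lecE => /andP[].
have A_le x : rnorm (A x) ^+ 2 <= C * rdot (A x) x.
  apply: rnorm_sqr_le_of_pos => //.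
  - by move=> t u v; rewrite linearB linearZ.
  - move=> u; rewrite Apos/= (le_trans (rdot_le _ _))// expr2 mulrA.
    by rewrite ler_wpM2r ?rnorm_ge0.
pose B x := x - (C^-1)%:C *: A x.
have BL a x y : B (a *: x + y) = a *: B x + B y.
  have AP : A (a *: x + y) = a *: A x + A y by exact: linearP.
  by rewrite /B AP scalerBr scalerDr !scalerA (mulrC a) opprD addrACA.
(* Expanding, |B x|^2 = |x|^2 - (2/C) <A x, x> + |A x|^2 / C^2, and |A x|^2 <= C <A x, x>. *)
have B1 x : rnorm (B x) <= rnorm x.
  rewrite -ler_sqr ?nnegrE ?rnorm_ge0// rnorm_sqrB rdotZr rnormZr exprMn.
  rewrite real_normK ?num_real// (rdotC x).
  have := ler_wpM2l (sqr_ge0 C^-1) (A_le x).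
  rewrite (_ : C^-1 ^+ 2 * (C * _) = C^-1 * rdot (A x) x); last first.
    by field; rewrite gt_eqF.
  have : 0 <= C^-1 * rdot (A x) x by rewrite mulr_ge0// invr_ge0 ltW.
  lra.
have Bs x y : rdot (B x) y = rdot x (B y).
  by rewrite /B rdotBl rdotBr rdotZl rdotZr As.
have [Y [YL Y1 Ys BY]] := contraction_half_square BL B1 Bs.
pose c : R := Num.sqrt C.
have cc : c * c = C by rewrite -expr2 sqr_sqrtr// ltW.
have c0 : 0 <= c by exact: sqrtr_ge0.
pose S x := c%:C *: (x - Y x).
have SL a x y : S (a *: x + y) = a *: S x + S y.
  by rewrite /S YL opprD addrACA -scalerBr scalerDr !scalerA mulrC.
have SC x : rnorm (S x) <= (c * 2) * rnorm x.
  rewrite /S rnormZr ger0_norm// -mulrA ler_wpM2l// (le_trans (rnormB _ _))//.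
  by rewrite mulr_natl mulr2n lerD2l.
have [S' SS] := bop_of SL SC.
have S'P : nonneg_operator S' /\ forall x, S' (S' x) = A x.
  split=> [|x].
    apply: nonneg_of_rdot => [x y|x]; rewrite !SS /S.
      by rewrite rdotZl rdotZr rdotBl rdotBr Ys.
    rewrite rdotZl rdotBl rdotxx mulr_ge0// subr_ge0 (le_trans (rdot_le _ _))//.
    by rewrite expr2 ler_wpM2r ?rnorm_ge0.
  have SZ (a : R[i]) u : S (a *: u) = a *: S u.
    have S0 : S 0 = 0.
      by have := SL (-1) 0 0; rewrite scaleN1r oppr0 addr0 scaleN1r addNr.
    by rewrite -[a *: u]addr0 SL S0 addr0.
  have YB u v : Y (u - v) = Y u - Y v.
    by have := YL (-1) v u; rewrite !scaleN1r addrC => ->; rewrite addrC.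
  rewrite !SS {2}/S SZ /S scalerA -rmorphM/= cc YB opprB.
  have -> : x - Y x + (Y (Y x) - Y x) = (C^-1)%:C *: A x.
    have -> : Y (Y x) = 2 *: Y x - B x by rewrite -BY addrAC subrr add0r.
    by rewrite scaler_nat mulr2n (addrAC _ (- B x)) addrK addrA subrK /B subKr.
  by rewrite scalerA -rmorphM/= divff ?gt_eqF// scale1r.
exact: (@xgetPex _ (bop0 H H)
  [set S : 'L(H) | nonneg_operator S /\ forall x, S (S x) = A x]
  (ex_intro _ S' S'P)).
Qed.

End SquareRoot.

(** * Parts of the weighted backward shift *)

(** Applied with (a, b) = (alpha, k) for positivity on a part, and with (k, alpha) for the isometry
    of the model. *)
Lemma series_convol_delta0 (R : realType) (a b F s : R^nat) :
  convol a b = delta0 R ->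
  (forall n, series (fun j => b j * F (n + j)%N) @ \oo --> s n) ->
  cvgn (series (fun m =>
    convol (fun n => `|a n|) (fun n => `|b n|) m * `|F m|)) ->
  series (fun n => a n * s n) @ \oo --> F 0%N.
Proof.
move=> ab bs cF; have := cvg_series_convol bs cF; rewrite ab => h.
have c0 : series (fun m => delta0 R m * F m) @ \oo --> F 0%N.
  apply: cvg_near_cst; exists 1%N => // -[//|N] _.
  rewrite -[LHS]/(\sum_(0 <= i < N.+1) delta0 R i * F i) big_nat_recl//.
  by rewrite mul1r big1 ?addr0// => i _; rewrite mul0r.
rewrite -[F 0%N]add0r (_ : series _ = (fun N => series (fun n => a n * s n) N -
   series (fun m => delta0 R m * F m) N + series (fun m => delta0 R m * F m) N)).
  exact: cvgD.
by apply/funext => N; rewrite subrK.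
Qed.

Lemma convol_dominated_cvg (R : realType) (c k F : R^nat) (D : R) :
  (forall n, 0 <= c n) -> (forall n, 0 <= k n) -> (forall n, 0 <= F n) ->
  (forall n, convol c k n <= D * k n) -> cvgn (series (fun n => F n * k n)) ->
  cvgn (series (fun n => convol c k n * F n)) /\
  limn (series (fun n => convol c k n * F n)) <=
    D * limn (series (fun n => F n * k n)).
Proof.
move=> c0 k0 F0 ck cF.
have le n : convol c k n * F n <= (D *: (fun n => F n * k n)) n.
  by rewrite -[leRHS]/(D * (F n * k n)) mulrCA mulrC ler_wpM2l.
have cD : cvgn (series (D *: (fun n => F n * k n))) by exact: is_cvg_seriesZ.
have ge n : 0 <= convol c k n * F n by rewrite mulr_ge0// convol_ge0.
have cc : cvgn (series (fun n => convol c k n * F n)).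
  by apply: (series_le_cvg ge _ le cD) => n; exact: le_trans (ge n) (le n).
have lD : limn (series (D *: (fun n => F n * k n))) =
  D * limn (series (fun n => F n * k n)) := lim_seriesZ D cF.
split=> //; rewrite -lD; apply: ler_lim => //.
by apply: nearW => N; apply: ler_sum => i _; exact: le.
Qed.

Section WeightedShift.
Variables (R : realType) (k : nat -> {posnum R}) (E : normedModType R[i]).
Implicit Types f g : weighted_space k E.

Lemma weighted_rnorm f :
  series (fun n => rnorm (f n) ^+ 2 * (k n)%:num) @ \oo --> rnorm f ^+ 2.
Proof.
have cf : cvgn (series (weighted_terms k f)) := asboolW (coefsP f).
suff -> : rnorm f ^+ 2 = limn (series (weighted_terms k f)) by [].
rewrite /rnorm weighted_space_normE/= sqr_sqrtr//.
apply: limr_ge => //; apply: nearW => n; exact: weighted_series_ge0.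
Qed.

Variable C : R.
Hypothesis kC : forall n, (k n)%:num <= C * (k n.+1)%:num.

Let C_ge0 : 0 <= C.
Proof.
have : 0 < C * (k 1%N)%:num by apply: lt_le_trans (kC 0%N).
by rewrite pmulr_lgt0// => /ltW.
Qed.

(** Replace k_n by C k_(n+1) and restore the missing term of index 0. *)
Lemma weighted_shift_series f N :
  series (fun n => rnorm (f n.+1) ^+ 2 * (k n)%:num) N <= C * rnorm f ^+ 2.
Proof.
have cf := @weighted_rnorm f.
apply: (@le_trans _ _ (C * \sum_(n < N.+1) rnorm (f n) ^+ 2 * (k n)%:num)).
  rewrite seriesEord/= big_ord_recl mulrDr mulr_sumr -[leLHS]add0r.
  apply: lerD; first by rewrite mulr_ge0// mulr_ge0// sqr_ge0.
  by apply: ler_sum => i _; rewrite mulrCA ler_wpM2l// sqr_ge0.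
rewrite ler_wpM2l// -(cvg_lim _ cf)//.
apply: (@sum_le_lim _ (fun n => rnorm (f n) ^+ 2 * (k n)%:num)).
  by move=> n; rewrite mulr_ge0// sqr_ge0.
exact: cvgP cf.
Qed.

(** The shifted coefficients have finite norm, so [insubd] does not return its default 0. *)
Lemma backward_shiftE f n : backward_shift f n = f n.+1.
Proof.
rewrite /backward_shift; set g := fun n => f n.+1.
have gP : weighted_pred k g.
  apply/asboolP/nondecreasing_is_cvgn; first exact: weighted_series_nd.
  by exists (C * rnorm f ^+ 2) => _ [N _ <-]; exact: weighted_shift_series.
by have -> := congr1 (fun h => h n) (insubdK (0 : weighted_space k E) gP).
Qed.

Lemma backward_shift_linear a f g :
  backward_shift (a *: f + g) = a *: backward_shift f + backward_shift g.
Proof.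
apply: val_inj; apply/funext => n /=.
by rewrite backward_shiftE !coefsD !coefsZ -[RHS]/(a *: _ + _) !backward_shiftE.
Qed.

Lemma backward_shift_rnorm f :
  rnorm (backward_shift f) <= Num.sqrt C * rnorm f.
Proof.
rewrite -ler_sqr ?nnegrE ?mulr_ge0 ?rnorm_ge0 ?sqrtr_ge0//.
rewrite exprMn (sqr_sqrtr C_ge0).
rewrite -(cvg_lim _ (@weighted_rnorm (backward_shift f)))//.
apply: limr_le; first exact: cvgP (@weighted_rnorm _).
apply: nearW => N.
by under eq_fun do rewrite backward_shiftE; exact: weighted_shift_series.
Qed.

Lemma backward_shift_is_bounded : backward_shift_bounded k E.
Proof.
split; first exact: backward_shiftE.
have [B BE] := bop_of backward_shift_linear backward_shift_rnorm.
by exists B.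
Qed.

End WeightedShift.

Section PartsOfShift.
Variables (R : realType) (k : nat -> {posnum R}) (C : R).
Hypothesis kC : forall n, (k n)%:num <= C * (k n.+1)%:num.
Variables (H : hilbertType R) (T : 'L(H)).
Let kk n : R := (k n)%:num.
Let kk_ge0 n : 0 <= kk n. Proof. by rewrite /kk. Qed.
Let kk_abs : (fun n => `|kk n|) = kk.
Proof. by apply/funext => n; rewrite ger0_norm. Qed.

(* F n is the squared norm of the n-th coefficient of the image of x. *)
Lemma part_coefficients (E : hilbertType R) :
  unitarily_equivalent_to_part T (@backward_shift R k E) ->
  forall x, exists2 F : R^nat, (forall n, 0 <= F n) & forall m,
    series (fun j => kk j * F (m + j)%N) @ \oo --> rnorm (iter m T x) ^+ 2.
Proof.
move=> [M [TM [U [_ Un UT]]]] x; pose f y := val (U y) : weighted_space k E.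
have fT y : f (T y) = backward_shift (f y) by rewrite /f UT.
have fn y : rnorm (f y) = rnorm y by rewrite /rnorm -Un.
have fi m j : f (iter m T x) j = f x (m + j)%N.
  elim: m j => [//|m ih] j.
  by rewrite iterS fT (backward_shiftE kC) ih addnS addSn.
exists (fun n => rnorm (f x n) ^+ 2) => [n|m]; first exact: sqr_ge0.
rewrite -fn; have := @weighted_rnorm _ _ _ (f (iter m T x)).
by under eq_fun do rewrite fi mulrC.
Qed.

(** Domination of c * k by D k both justifies the rearrangement and bounds the quadratic forms
    uniformly by D |x|^2, which is enough for strong convergence. *)
Lemma part_hereditary_cvg (E : hilbertType R) (c : R^nat) (D : R) :
  unitarily_equivalent_to_part T (@backward_shift R k E) ->
  0 < D -> (forall n, 0 <= c n) -> (forall n, convol c kk n <= D * kk n) ->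
  hereditary_cvg c T.
Proof.
move=> /part_coefficients TF D0 c0 cD.
apply: (hereditary_cvg_bounded D0) => // N x.
have [F F0 kF] := TF x; have k0F := kF 0%N; rewrite /= in k0F.
have kF0 : series (fun n => F n * kk n) @ \oo --> rnorm x ^+ 2.
  by move: k0F; under eq_fun do rewrite mulrC add0n.
have [cc lc] := convol_dominated_cvg c0 kk_ge0 F0 cD (cvgP _ kF0).
rewrite (cvg_lim _ kF0)// in lc.
have h : (fun N => series (fun n => c n * rnorm (iter n T x) ^+ 2) N -
            series (fun m => convol c kk m * F m) N) @ \oo --> 0.
  apply: (cvg_series_convol kF); move: cc.
  by congr (cvgn (series _)); apply/funext => n; rewrite ger0_norm//;
    congr (convol _ _ _ * _); apply/funext => j; rewrite ger0_norm.
have h2 : series (fun n => c n * rnorm (iter n T x) ^+ 2) @ \oo -->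
    limn (series (fun m => convol c kk m * F m)).
  rewrite -[X in _ --> X]add0r (_ : series _ = (fun N =>
    series (fun n => c n * rnorm (iter n T x) ^+ 2) N -
    series (fun m => convol c kk m * F m) N +
    series (fun m => convol c kk m * F m) N)); first exact: cvgD.
  by apply/funext => n; rewrite subrK.
apply: le_trans lc; rewrite -(cvg_lim _ h2)//.
apply: (@sum_le_lim _ (fun n => c n * rnorm (iter n T x) ^+ 2)).
  by move=> n; rewrite mulr_ge0// sqr_ge0.
exact: cvgP h2.
Qed.

Variables (alpha : R^nat) (D : R).
Hypothesis alpha_k : convol alpha kk = delta0 R.
Hypothesis D_gt0 : 0 < D.
Hypothesis alpha_D : forall n, convol (fun n => `|alpha n|) kk n <= D * kk n.

(** The quadratic form of alpha(T^*, T) collapses to F 0, the squared norm of the constant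
    coefficient. *)
Lemma part_nonneg (E : hilbertType R) :
  unitarily_equivalent_to_part T (@backward_shift R k E) ->
  nonneg_operator (hereditary alpha T).
Proof.
move=> TE; have /hereditary_cvg_normr/hereditaryP aS :=
  part_hereditary_cvg TE D_gt0 (fun n => normr_ge0 (alpha n)) alpha_D.
apply: nonneg_of_rdot => [x y|x]; first exact: hereditary_sum_symmetric aS.
have [F F0 kF] := part_coefficients TE x.
suff : rdot (hereditary alpha T x) x = F 0%N by move=> ->.
apply: (cvg_unique _ (@hereditary_sum_rnorm _ _ _ _ _ x aS)) => //.
have h : series (fun n => alpha n * rnorm (iter n T x) ^+ 2) @ \oo --> F 0%N.
  apply: (series_convol_delta0 alpha_k kF).
  have k0F := kF 0%N; rewrite /= in k0F.
  have kF0 : series (fun n => F n * kk n) @ \oo --> rnorm x ^+ 2.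
    by move: k0F; under eq_fun do rewrite mulrC add0n.
  have [cc _] := convol_dominated_cvg (fun n => normr_ge0 (alpha n)) kk_ge0 F0
    alpha_D (cvgP _ kF0).
  by rewrite kk_abs; under eq_fun do rewrite (ger0_norm (F0 _)).
by move: h; rewrite seriesEord.
Qed.

Hypotheses (alpha_T : hereditary_cvg (fun n => `|alpha n|) T)
  (k_T : hereditary_cvg kk T) (alpha_ge0 : nonneg_operator (hereditary alpha T)).

(** Here |D T^n x|^2 = sum_j alpha_j |T^(n+j) x|^2. The rearrangement is legitimate since |alpha| *
    k is dominated by k and sum_n k_n |T^n x|^2 converges. *)
Lemma defect_isometry x :
  series (fun n => rnorm (defect_operator alpha T (iter n T x)) ^+ 2 * kk n)
    @ \oo --> rnorm x ^+ 2.
Proof.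
have [Dge DD] := operator_sqrtP alpha_ge0.
rewrite -/(defect_operator _ _) in Dge DD.
have aS := hereditaryP (hereditary_cvg_normr alpha_T).
pose F n := rnorm (iter n T x) ^+ 2.
have F0 n : 0 <= F n by exact: sqr_ge0.
have kF : cvgn (series (fun n => F n * kk n)).
  have [S kS] := k_T; have := cvgP _ (@hereditary_sum_rnorm _ _ _ _ _ x kS).
  by rewrite seriesEord; under eq_fun do under eq_bigr do rewrite mulrC.
have [cc _] := convol_dominated_cvg (fun n => normr_ge0 (alpha n)) kk_ge0 F0
    alpha_D kF.
have ka : convol kk alpha = delta0 R by rewrite convolC.
under eq_fun do rewrite mulrC.
apply: (@series_convol_delta0 _ kk alpha F
  (fun n => rnorm (defect_operator alpha T (iter n T x)) ^+ 2) ka) => [n|].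
  have -> : rnorm (defect_operator alpha T (iter n T x)) ^+ 2 =
      rdot (hereditary alpha T (iter n T x)) (iter n T x).
    by rewrite -rdotxx -(nonneg_symmetric Dge) DD.
  have := @hereditary_sum_rnorm _ _ _ _ _ (iter n T x) aS.
  rewrite seriesEord /F.
  by under eq_fun do under eq_bigr do rewrite -iterD addnC.
by rewrite kk_abs convolC; under eq_fun do rewrite (ger0_norm (F0 _)).
Qed.

End PartsOfShift.

(** * Construction of the model space *)

Section Model.
Variable R : realType.

(** Preimages of a sequence converging to y form a Cauchy sequence, and the image of their limit is
    y. *)
Lemma isometry_closed_range (V : completeNormedModType R[i])
    (W : normedModType R[i]) (U : {linear V -> W}) :
  (forall x, rnorm (U x) = rnorm x) -> closed (range U).
Proof.
move=> Ui y cly.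
have : forall n : nat, exists x, rnorm (U x - y) < (n.+1%:R : R)^-1.
  move=> n; have n0 : 0 < ((n.+1%:R : R)^-1)%:C by rewrite ltcR invr_gt0.
  have [_ [[x _ <-]]] := cly _ (nbhsx_ballx y _ n0).
  by rewrite -ball_normE/= -rnormE ltcR rdistC => ?; exists x.
move=> /choice[u uy].
have inv0 : (fun n => (n.+1%:R : R)^-1) @ \oo --> (0 : R).
  exact: cvg_harmonic.
have Uuy : (fun n => rnorm (U (u n) - y)) @ \oo --> (0 : R).
  apply: (squeeze_cvgr _ (cvg_cst 0) inv0).
  by apply: nearW => n; rewrite rnorm_ge0 ltW.
have [x ux] : exists x, (fun n => rnorm (u n - x)) @ \oo --> (0 : R).
  apply: rnorm_complete => e e0.
  have e2 : 0 < e / 2 by rewrite divr_gt0.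
  have /cvgr0Pnorm_le/(_ _ e2)[N _ NE] := Uuy.
  exists N => n m Nn nm; rewrite -Ui linearB.
  have := NE _ Nn; have := NE _ (leq_trans Nn nm).
  rewrite !ger0_norm ?rnorm_ge0// => h1 h2.
  rewrite -(subrK y (U (u m))) -addrA (le_trans (rnormD _ _))//.
  by rewrite (rdistC y); lra.
exists x => //; apply: (cvg_rnorm_unique _ Uuy).
by under eq_fun do rewrite -linearB Ui.
Qed.

Variables (k : nat -> {posnum R}) (C : R).
Hypothesis kC : forall n, (k n)%:num <= C * (k n.+1)%:num.

(** V x lists the coefficients of the image of x. The resulting map is an isometry, so its range is
    a closed invariant subspace and serves as the part. *)
Lemma part_of_intertwining (H E : hilbertType R) (S : H -> H)
    (V : H -> nat -> E) :
  (forall n a x y, V (a *: x + y) n = a *: V x n + V y n) ->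
  (forall x n, V (S x) n = V x n.+1) ->
  (forall x, series (fun n => rnorm (V x n) ^+ 2 * (k n)%:num) @ \oo -->
    rnorm x ^+ 2) ->
  unitarily_equivalent_to_part S (@backward_shift R k E).
Proof.
move=> VL VS Vn.
have VP x : weighted_pred k (V x) by apply/asboolP; exact: cvgP (Vn x).
pose W x : weighted_space k E := WeightedSpace (VP x).
have WL a x y : W (a *: x + y) = a *: W x + W y.
  apply: val_inj; apply/funext => n.
  by rewrite -[val (_ + _)]/(coefs _) coefsD coefsZ; exact: VL.
have Wi x : rnorm (W x) = rnorm x.
  apply/eqP; rewrite -(eqrXn2 (n := 2)) ?rnorm_ge0//; apply/eqP.
  by apply: (cvg_unique _ (@weighted_rnorm _ _ _ (W x)) (Vn x)).
have W1 x : rnorm (W x) <= 1 * rnorm x by rewrite Wi mul1r.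
have [U UW] := bop_of WL W1.
have Ui x : rnorm (U x) = rnorm x by rewrite UW.
pose M : closed_subspace (weighted_space k E) :=
  ClosedSubspace (isometry_closed_range Ui) (range_submod U).
have US x : backward_shift (U x) = U (S x).
  apply: val_inj; apply/funext => n.
  by rewrite /= (backward_shiftE kC) !UW /= VS.
have TM : Defs.invariant (@backward_shift R k E) M.
  by move=> _ [x _ <-]; exists (S x).
have UM x : subspace_pred M (U x) by apply: mem_set; exists x.
have QL a x y : SubspaceElt (UM (a *: x + y)) =
    a *: SubspaceElt (UM x) + SubspaceElt (UM y).
  by apply: val_inj; rewrite /= linearP.
have [Q QU] := @linear_fun_of _ _ _ (fun x => SubspaceElt (UM x)) QL.
exists M, TM, Q; split=> [|x|x].
- have Qsurj z : exists x, Q x = z.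
    have [x _ xz] := set_mem (valP z); exists x; rewrite QU.
    exact: val_inj.
  have [g Qg] := choice Qsurj; exists g => // x.
  (* A right inverse of an isometry is also a left inverse, by injectivity. *)
  have : Q (g (Q x) - x) = 0 by rewrite linearB Qg subrr.
  rewrite QU => /(congr1 val)/= Ux0; apply/eqP; rewrite -subr_eq0; apply/eqP.
  by apply: rnorm_eq0; rewrite -Ui Ux0 rnorm0.
- by rewrite QU -!rnormE; congr (_%:C); rewrite -Ui.
- by rewrite !QU; apply: val_inj; rewrite /= US.
Qed.

End Model.

(** The coefficients D T^n x are read in the closure of the range of D, so the coefficient space is
    the defect space itself. *)
Lemma defect_model (R : realType) (k : nat -> {posnum R}) (C D : R)
    (alpha : R^nat) (H : hilbertType R) (T : 'L(H)) :
  (forall n, (k n)%:num <= C * (k n.+1)%:num) ->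
  convol alpha (fun n => (k n)%:num) = delta0 R ->
  (forall n, convol (fun n => `|alpha n|) (fun n => (k n)%:num) n <=
    D * (k n)%:num) ->
  hereditary_cvg (fun n => `|alpha n|) T ->
  hereditary_cvg (fun n => (k n)%:num) T ->
  nonneg_operator (hereditary alpha T) ->
  unitarily_equivalent_to_part T (@backward_shift R k (defect_space alpha T)).
Proof.
move=> kC ak aD aT kT A0.
have inD x : subspace_pred (range_closure (defect_operator alpha T))
    (defect_operator alpha T x).
  by apply/mem_set/subset_closure; exists x.
have itl n a x y : iter n T (a *: x + y) = a *: iter n T x + iter n T y.
  by elim: n => //= n ->; rewrite linearP.
apply: (@part_of_intertwining _ _ _ kC _ (defect_space alpha T) T
  (fun x n => SubspaceElt (inD (iter n T x)))).
- by move=> n a x y; apply: val_inj; rewrite /= itl linearP.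
- by move=> x n; apply: val_inj; rewrite /= -iterSr.
- move=> x; exact: (defect_isometry ak aD aT kT A0).
Qed.

Theorem theorem1p5 (R : realType) (alpha : nat -> R) (k : nat -> {posnum R})
  (alpha_wiener : wiener alpha)
  (alpha_neq0 : forall z : R[i], `|z| < 1 -> pseries_sum alpha z != 0)
  (alpha0 : alpha 0%N = 1)
  (k_inv : forall z : R[i], `|z| < 1 ->
    pseries_sum (fun n => (k n)%:num) z = (pseries_sum alpha z)^-1)
  (k_wiener : wiener (fun n => (k n)%:num))
  (k_root : ((k n)%:num `^ n%:R^-1) @[n --> \oo] --> (1 : R))
  (k_ratio : has_ubound (range (fun n => (k n)%:num / (k n.+1)%:num : R)))
  (k_tail :
    ereal_sup [set (\sum_(m <= j < n./2.+1)
        (k j)%:num * (k (n - j)%N)%:num / (k n)%:num)%:E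
      | n in [set n | (2 * m <= n)%N]] @[m --> \oo] --> (0 : \bar R)) :
  backward_shift_bounded k R[i]^o /\
  forall (H : hilbertType R) (T : 'L(H)),
    ((exists E : hilbertType R,
        unitarily_equivalent_to_part T (@backward_shift R k E)) <->
     [/\ hereditary_cvg (fun n => `|alpha n|) T,
         hereditary_cvg (fun n => (k n)%:num) T
       & nonneg_operator (hereditary alpha T)]) /\
    ([/\ hereditary_cvg (fun n => `|alpha n|) T,
         hereditary_cvg (fun n => (k n)%:num) T
       & nonneg_operator (hereditary alpha T)] ->
     unitarily_equivalent_to_part T
       (@backward_shift R k (defect_space alpha T))).
Proof.
pose kk n : R := (k n)%:num.
have kk_gt0 n : 0 < kk n by rewrite /kk.
have kk_ge0 n : 0 <= kk n by rewrite /kk.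
have [C C0 kC] := weight_ratio kk_gt0 k_ratio.
have tail := weight_tail kk_gt0 k_tail.
have [D D0 kD] := convol_self_bound kk_gt0 tail kC.
have root := weight_root kk_gt0 k_root.
have kabs : (fun n => `|kk n|) = kk by apply/funext => n; rewrite ger0_norm.
have k_sum : cvgn (series kk) by rewrite -kabs.
have ak : convol alpha kk = delta0 R by exact: convol_inverse.
have [B B0 aB] :=
  inverse_bound kk_gt0 tail (ex_intro2 _ _ D D0 kD) root k_sum ak alpha_wiener.
(* Chain |alpha| <= B k with k * k <= D k. *)
have aD n : convol (fun n => `|alpha n|) kk n <= B * D * kk n.
  apply: (@le_trans _ _ (convol (B *: kk) kk n)); first exact: convol_le.
  rewrite convolZl -[leLHS]/(B * convol kk kk n) -mulrA ler_wpM2l//.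
  exact: ltW.
have BD0 : 0 < B * D by rewrite mulr_gt0.
split; first exact: backward_shift_is_bounded kC.
move=> H T; split; last first.
  by move=> [aT kT A0]; exact: defect_model kC ak aD aT kT A0.
split=> [[E TE]|[aT kT A0]].
  split.
  - by apply: (part_hereditary_cvg kC TE BD0) => // n; exact: normr_ge0.
  - exact: (part_hereditary_cvg kC TE D0).
  - exact: (part_nonneg kC ak BD0 aD TE).
exists (defect_space alpha T); exact: defect_model kC ak aD aT kT A0.
Qed.
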